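(* Let $r\ge 4$ be an integer and let $F$ be the graph obtained from the complete graph $K_r$ by deleting the edges of vertex-disjoint paths $P_{k_1},\dots,P_{k_l}$ contained in $K_r$ (where $P_{k}$ denotes a path on $k$ vertices and each $k_i\ge 2$), i.e. $F=K_r-E\big(\bigcup_{i=1}^{l}P_{k_i}\big)$ with $V(P_{k_i})\cap V(P_{k_j})=\emptyset$ for $i\ne j$. Then there exists $N$ (depending on $F$) such that for every $F$-minor free graph $G$ on $n\ge N$ vertices: (i) if $k_1=\cdots=k_l=2$, then $\lambda(G)\le \lambda(F_{n,r-3})$, with equality if and only if $G= F_{n,r-3}$; (ii) if $k_i\ge 3$ for at least one $i$, then $\lambda(G)\le \lambda(S_{n,r-3})$, with equality if and only if $G= S_{n,r-3}$.
   Context: All graphs are finite and simple. $\lambda(G)$ denotes the spectral radius (largest eigenvalue) of the adjacency matrix of $G$. A graph $H$ is a minor of $G$ if $H$ can be obtained from $G$ by vertex deletions, edge deletions and edge contractions; $G$ is $H$-minor free if it has no minor isomorphic to $H$. For graphs $G,H$, $G\nabla H$ is their join (disjoint union plus all edges between them), $G\cup H$ their disjoint union, and $pK_2$ is $p$ disjoint edges. $S_{n,t}=K_t\nabla \overline{K}_{n-t}$ (a clique on $t$ vertices joined to an independent set of $n-t$ vertices). $F_{n,t}=K_t\nabla(pK_2\cup K_q)$ where $n-t=2p+q$ and $q\in\{0,1\}$ (a clique on $t$ vertices joined to a graph on $n-t$ vertices consisting of a maximum matching and at most one isolated vertex). *)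

(* Defs.v *)
From mathcomp Require Import all_boot all_order all_algebra.
From mathcomp Require Import classical_sets reals.

Set Implicit Arguments.
Unset Strict Implicit.
Unset Printing Implicit Defensive.

Import Order.TTheory GRing.Theory Num.Theory.

Record sgraph := SGraph {
  vertex :> finType;
  edge : rel vertex;
  edge_sym : symmetric edge;
  edge_irrefl : irreflexive edge
}.

Definition isomorphic (G H : sgraph) : Prop :=
  exists2 f : G -> H, bijective f & {mono f : x y / edge x y}.

Section SpectralRadius.
Local Open Scope ring_scope.
Local Open Scope classical_set_scope.

Definition adjmx (R : realType) (G : sgraph) : 'M[R]_#|G| :=
  \matrix_(i, j) (edge (enum_val i) (enum_val j))%:R.

(* A real symmetric matrix of positive size has a finite nonempty set of      *)
(* eigenvalues, so the supremum is the largest eigenvalue; it is 0 for the    *)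
(* graph without vertices.                                                    *)
Definition spectral_radius (R : realType) (G : sgraph) : R :=
  sup [set a : R | eigenvalue (adjmx R G) a].

End SpectralRadius.

Section Constructions.

Fact complete_sym n : symmetric (fun x y : 'I_n => x != y).
Proof. by move=> x y; rewrite eq_sym. Qed.
Fact complete_irrefl n : irreflexive (fun x y : 'I_n => x != y).
Proof. by move=> x; rewrite eqxx. Qed.
Definition complete n : sgraph :=
  SGraph (@complete_sym n) (@complete_irrefl n).

Fact edgeless_sym n : symmetric (fun x y : 'I_n => false).
Proof. by []. Qed.
Fact edgeless_irrefl n : irreflexive (fun x y : 'I_n => false).
Proof. by []. Qed.
Definition edgeless n : sgraph :=
  SGraph (@edgeless_sym n) (@edgeless_irrefl n).

(* p K_2: the two ends of the i-th edge are (i, false) and (i, true). *)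
Definition matching_rel p : rel ('I_p * bool) :=
  fun x y => (x.1 == y.1) && (x.2 != y.2).
Fact matching_sym p : symmetric (@matching_rel p).
Proof. by move=> x y; rewrite /matching_rel eq_sym [x.2 == _]eq_sym. Qed.
Fact matching_irrefl p : irreflexive (@matching_rel p).
Proof. by move=> x; rewrite /matching_rel !eqxx. Qed.
Definition matching p : sgraph :=
  SGraph (@matching_sym p) (@matching_irrefl p).

Variables G H : sgraph.

Definition gunion_rel : rel (G + H) := fun x y =>
  match x, y with
  | inl a, inl b => edge a b
  | inr a, inr b => edge a b
  | _, _ => false
  end.
Fact gunion_sym : symmetric gunion_rel.
Proof. by move=> [x|x] [y|y] //=; rewrite edge_sym. Qed.
Fact gunion_irrefl : irreflexive gunion_rel.
Proof. by move=> [x|x] /=; rewrite edge_irrefl. Qed.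
Definition gunion : sgraph := SGraph gunion_sym gunion_irrefl.

Definition join_rel : rel (G + H) := fun x y =>
  match x, y with
  | inl a, inl b => edge a b
  | inr a, inr b => edge a b
  | _, _ => true
  end.
Fact join_sym : symmetric join_rel.
Proof. by move=> [x|x] [y|y] //=; rewrite edge_sym. Qed.
Fact join_irrefl : irreflexive join_rel.
Proof. by move=> [x|x] /=; rewrite edge_irrefl. Qed.
Definition join : sgraph := SGraph join_sym join_irrefl.

End Constructions.

(* S_{n,t} and F_{n,t}; both have n vertices only when t <= n, since n - t is *)
(* truncated.                                                                 *)
Definition graphS n t : sgraph := join (complete t) (edgeless (n - t)).
Definition graphF n t : sgraph :=
  join (complete t)
       (gunion (matching (n - t)./2) (complete (odd (n - t)))).

Section Minors.
Variable G : sgraph.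

Definition del_vertex_rel (v : G) : rel {x : G | x != v} :=
  fun x y => edge (val x) (val y).
Fact del_vertex_sym v : symmetric (@del_vertex_rel v).
Proof. by move=> x y; rewrite /del_vertex_rel edge_sym. Qed.
Fact del_vertex_irrefl v : irreflexive (@del_vertex_rel v).
Proof. by move=> x; rewrite /del_vertex_rel edge_irrefl. Qed.
Definition del_vertex v : sgraph :=
  SGraph (@del_vertex_sym v) (@del_vertex_irrefl v).

Definition del_edge_rel (u v : G) : rel G :=
  fun x y => edge x y && ([set x; y] != [set u; v]).
Fact del_edge_sym u v : symmetric (del_edge_rel u v).
Proof. by move=> x y; rewrite /del_edge_rel edge_sym finset.setUC. Qed.
Fact del_edge_irrefl u v : irreflexive (del_edge_rel u v).
Proof. by move=> x; rewrite /del_edge_rel edge_irrefl. Qed.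
Definition del_edge u v : sgraph :=
  SGraph (del_edge_sym u v) (del_edge_irrefl u v).

(* v is merged into u: the neighbours of v become neighbours of u; the loop   *)
(* at u and multiple edges are discarded.                                     *)
Definition contract_rel (u v : G) : rel {x : G | x != v} := fun x y =>
  (x != y) && [|| edge (val x) (val y),
                  (val x == u) && edge v (val y)
                | (val y == u) && edge v (val x)].
Fact contract_sym u v : symmetric (@contract_rel u v).
Proof.
by move=> x y; rewrite /contract_rel eq_sym edge_sym [X in _ || X]orbC.
Qed.
Fact contract_irrefl u v : irreflexive (@contract_rel u v).
Proof. by move=> x; rewrite /contract_rel eqxx. Qed.
Definition contract u v : sgraph :=
  SGraph (@contract_sym u v) (@contract_irrefl u v).

End Minors.

(* minor G M: M is obtained from G by a finite sequence of operations. *)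
Inductive minor (G : sgraph) : sgraph -> Prop :=
| minor_refl : minor G G
| minor_del_vertex (M : sgraph) (v : M) :
    minor G M -> minor G (del_vertex v)
| minor_del_edge (M : sgraph) (u v : M) :
    edge u v -> minor G M -> minor G (del_edge u v)
| minor_contract (M : sgraph) (u v : M) :
    edge u v -> minor G M -> minor G (contract u v).

Definition minor_free (H G : sgraph) : Prop :=
  ~ exists2 M : sgraph, minor G M & isomorphic M H.

Section DeletedPaths.
Variable r : nat.

(* A path on k vertices in K_r is the sequence of its k distinct vertices in  *)
(* order; zip lists the pairs of consecutive ones.                            *)
Definition path_edge (p : seq 'I_r) : rel 'I_r := fun x y =>
  ((x, y) \in zip p (behead p)) || ((y, x) \in zip p (behead p)).

Definition disjoint_paths (ps : seq (seq 'I_r)) : Prop :=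
  (forall p, p \in ps -> (2 <= size p) && uniq p) /\
  pairwise (fun p q : seq 'I_r => [disjoint p & q]) ps.

Variable ps : seq (seq 'I_r).

Definition complete_minus_paths_rel : rel 'I_r := fun x y =>
  (x != y) && ~~ has (fun p => path_edge p x y) ps.
Fact complete_minus_paths_sym : symmetric complete_minus_paths_rel.
Proof.
move=> x y; rewrite /complete_minus_paths_rel eq_sym.
by congr (_ && ~~ _); apply: eq_has => p; rewrite /path_edge orbC.
Qed.
Fact complete_minus_paths_irrefl : irreflexive complete_minus_paths_rel.
Proof. by move=> x; rewrite /complete_minus_paths_rel eqxx. Qed.
Definition complete_minus_paths : sgraph :=
  SGraph complete_minus_paths_sym complete_minus_paths_irrefl.

End DeletedPaths.

(* Main.v *)
(** Write [t = r - 3].  [F] lies in [K_r] minus an edge (minus two consecutive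
    edges in case (ii)).  If [t + 1] vertices of [G] have [r] common neighbours,
    or if [t] vertices have [r] common neighbours among which there is a path on
    three vertices (an edge in case (ii)), then [G] has an [F]-minor: pairing
    each hub with a private common neighbour makes the hubs pairwise adjacent.
    Moreover [G] is sparse, since dense graphs have [K_r]-minors.

    Let [x] be a Perron vector of [G] with maximum 1, where the spectral radius
    [m] of [G] is at least that of the target, so [m ^ 2 >= t (n - t)].  Counting
    2-walks weighted by [x] shows that vertices with [x v] bounded below have
    linear degree, hence are boundedly many.  All but boundedly many vertices
    have at most [t] neighbours among these, and comparing with [m ^ 2] forces
    exactly [t] of them, each with entry and relative degree close to 1.  Call
    this set [L], its common neighbourhood [A] and the remaining vertices [B].
    The edges inside [A] form a matching (case (i)) or are absent (case (ii)),
    so [A] embeds in the target.  Replacing the edges at [B] outside [L] by all edges between [B]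
    and [L] increases the quadratic form at [x], with equality only if [B] is
    empty, in which case [G] is the target. *)

Require Import Defs.
From mathcomp Require Import classical_sets reals.
From mathcomp Require Import all_boot all_order all_algebra.
From mathcomp Require Import ring lra zify.

Set Implicit Arguments.
Unset Strict Implicit.
Unset Printing Implicit Defensive.

Import Order.TTheory GRing.Theory Num.Theory.

(** * Symmetric matrices and Rayleigh quotients *)

Section SymmetricForms.
Local Open Scope ring_scope.
Variables (R : realType) (n : nat).
Implicit Types (A B : 'M[R]_n) (u v : 'rV[R]_n).

Definition bform A u v : R := (u *m A *m v^T) 0 0.
Definition sqnorm u : R := bform 1%:M u u.

Lemma bformE A u v : bform A u v = \sum_i \sum_j u 0 i * A i j * v 0 j.
Proof.
rewrite /bform mxE exchange_big /=; apply: eq_bigr => j _.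
by rewrite !mxE mulr_suml.
Qed.

Lemma sqnormE u : sqnorm u = \sum_i u 0 i ^+ 2.
Proof.
rewrite /sqnorm /bform mulmx1 mxE.
by apply: eq_bigr => i _; rewrite mxE.
Qed.

Lemma sqnorm_ge0 u : 0 <= sqnorm u.
Proof. by rewrite sqnormE sumr_ge0 // => i _; rewrite sqr_ge0. Qed.

Lemma sqnorm_gt0 u : (0 < sqnorm u) = (u != 0).
Proof.
rewrite lt_neqAle sqnorm_ge0 andbT eq_sym; congr (~~ _).
rewrite sqnormE; apply/eqP/eqP => [h|->]; last first.
  by rewrite big1 // => i _; rewrite mxE expr0n.
apply/rowP => i; rewrite mxE; apply/eqP; rewrite -sqrf_eq0; apply/eqP.
by apply: (psumr_eq0P _ h) => // j _; apply: sqr_ge0.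
Qed.

Lemma bform_sqnorm_bound A :
  exists2 C, 0 < C & forall u, bform A u u <= C * sqnorm u.
Proof.
exists (1 + \sum_i \sum_j `|A i j|) => [|u].
  rewrite ltr_wpDr ?ltr01 // sumr_ge0 // => i _.
  by rewrite sumr_ge0 // => j _; rewrite normr_ge0.
rewrite mulrDl mul1r ler_wpDl ?sqnorm_ge0 // bformE mulr_suml.
apply: ler_sum => i _; rewrite mulr_suml; apply: ler_sum => j _.
apply: le_trans (ler_norm _) _; rewrite !normrM [`|u 0 i| * _]mulrC -mulrA.
apply: ler_wpM2l => //.
have sq_le k : `|u 0 k| ^+ 2 <= sqnorm u.
  rewrite real_normK ?num_real // sqnormE (bigD1 k) //= lerDl sumr_ge0 //.
  by move=> l _; rewrite sqr_ge0.
have := sq_le i; have := sq_le j; nra.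
Qed.

(** For [c > 0] the minimizer [s = - b / c] gives the inequality. For [c = 0] the expression is
    affine in [s], and a nonzero [b] would let it reach -1. *)
Lemma quadratic_discriminant (a b c : R) : 0 <= c ->
  (forall s, 0 <= a + s * b *+ 2 + s ^+ 2 * c) -> b ^+ 2 <= a * c.
Proof.
move=> c0 h; case: (ltgtP c 0) c0 => // [c0 _|c0 _].
  have := h (- (b / c)).
  have -> : a + - (b / c) * b *+ 2 + (- (b / c)) ^+ 2 * c = (a * c - b ^+ 2) / c.
    by field; rewrite gt_eqF.
  by rewrite pmulr_lge0 ?invr_gt0 // subr_ge0.
have [->|b0] := eqVneq b 0; first by rewrite c0 expr0n mulr0.
have := h (- (a + 1) / (b *+ 2)).
have -> : a + - (a + 1) / (b *+ 2) * b *+ 2 + (- (a + 1) / (b *+ 2)) ^+ 2 * c = -1.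
  by rewrite c0; field.
by rewrite oppr_ge0 ler10.
Qed.

Lemma bformC B u v : B^T = B -> bform B u v = bform B v u.
Proof.
move=> Bsym; rewrite /bform.
transitivity ((u *m B *m v^T)^T 0 0); first by rewrite [RHS]mxE.
by rewrite !trmx_mul trmxK Bsym mulmxA.
Qed.

Lemma psd_cauchy_schwarz B u v : B^T = B -> (forall w, 0 <= bform B w w) ->
  bform B u v ^+ 2 <= bform B u u * bform B v v.
Proof.
move=> Bsym psd; apply: quadratic_discriminant => // s.
have := psd (u + s *: v).
suff -> : bform B (u + s *: v) (u + s *: v) =
          bform B u u + s * bform B u v *+ 2 + s ^+ 2 * bform B v v by [].
have := bformC v u Bsym.
rewrite /bform linearD linearZ /= !mulmxDl !mulmxDr -!scalemxAl -!scalemxAr.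
rewrite !mxE => ->; ring.
Qed.

Lemma bform_scalarB (A : 'M[R]_n) (m : R) u v :
  bform (m%:M - A) u v = m * bform 1%:M u v - bform A u v.
Proof.
by rewrite /bform mulmxBr mulmxBl mul_mx_scalar mulmx1 -scalemxAl !mxE.
Qed.

Lemma bform1_delta u i : bform 1%:M u (delta_mx 0 i) = u 0 i.
Proof.
rewrite /bform mulmx1 mxE (bigD1 i) //= !mxE !eqxx mulr1 big1 ?addr0 // => j ji.
by rewrite !mxE eqxx (negPf ji) mulr0.
Qed.

End SymmetricForms.

(** * The largest eigenvalue as the supremum of the Rayleigh quotients *)

Section TopEigenvalue.
Local Open Scope ring_scope.
Local Open Scope classical_set_scope.
Variables (R : realType) (n : nat) (A : 'M[R]_n.+1).
Hypothesis Asym : A^T = A.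

Let rayleigh := [set a : R | exists2 u : 'rV_n.+1, u != 0 & a = bform A u u / sqnorm u].
Let mu : R := sup rayleigh.

Let rayleigh_nonempty : rayleigh !=set0.
Proof.
pose u : 'rV[R]_n.+1 := delta_mx 0 0; exists (bform A u u / sqnorm u), u => //.
by apply/eqP => /rowP /(_ 0); rewrite !mxE !eqxx; apply/eqP; rewrite oner_eq0.
Qed.

Let rayleigh_bounded : has_ubound rayleigh.
Proof.
have [C _ hC] := bform_sqnorm_bound A; exists C => _ [u u0 ->].
by rewrite ler_pdivrMr ?sqnorm_gt0.
Qed.

Let bform_le_mu u : bform A u u <= mu * sqnorm u.
Proof.
have [->|u0] := eqVneq u 0.
  by rewrite /bform mul0mx mul0mx mxE sqnormE big1 ?mulr0 // => i _; rewrite mxE expr0n.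
by rewrite -ler_pdivrMr ?sqnorm_gt0 //; apply: ub_le_sup => //; exists u.
Qed.

Let shift := mu%:M - A.

Let shift_sym : shift^T = shift.
Proof. by rewrite /shift linearB /= tr_scalar_mx Asym. Qed.

Let shift_psd u : 0 <= bform shift u u.
Proof. by rewrite bform_scalarB subr_ge0 bform_le_mu. Qed.

(* If [shift] were invertible, Cauchy-Schwarz for its form would push the      *)
(* Rayleigh quotients away from their supremum.                                *)
Let shift_singular : shift \notin unitmx.
Proof.
apply/negP => U; have [K K0 hK] := bform_sqnorm_bound (invmx shift).
have K'0 : 0 < K^-1 by rewrite invr_gt0.
suff : mu <= mu - K^-1 by lra.
apply: ge_sup => // _ [u u0 ->]; have n0 := u0; rewrite -sqnorm_gt0 in n0.
rewrite ler_pdivrMr //.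
have := psd_cauchy_schwarz u (u *m invmx shift) shift_sym shift_psd.
have -> : bform shift u (u *m invmx shift) = sqnorm u.
  rewrite /bform trmx_mul trmx_inv shift_sym -mulmxA [X in u *m X]mulmxA.
  by rewrite mulmxV // mul1mx /sqnorm /bform mulmx1.
have -> : bform shift (u *m invmx shift) (u *m invmx shift) =
          bform (invmx shift) u u.
  rewrite /bform trmx_mul trmx_inv shift_sym mulmxKV // mulmxA.
  by [].
rewrite bform_scalarB -/(sqnorm u) => h.
have {h}: sqnorm u ^+ 2 <= (mu * sqnorm u - bform A u u) * (K * sqnorm u).
  by apply: le_trans h _; apply: ler_wpM2l; rewrite ?subr_ge0 ?bform_le_mu.
rewrite mulrA expr2 ler_pM2r // => h.
have {}h : sqnorm u / K <= mu * sqnorm u - bform A u u by rewrite ler_pdivrMr.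
rewrite mulrBl [K^-1 * _]mulrC; lra.
Qed.

(** The matrix [mu%:M - A] is positive semidefinite and singular. Singularity yields an eigenvector.
    A vector attaining the bound has zero form under the shift, so by Cauchy-Schwarz it pairs to
    zero with every vector and lies in the kernel. *)
Lemma rayleigh_spectrum : exists m : R,
  [/\ m = sup [set a : R | eigenvalue A a],
      forall u : 'rV_n.+1, bform A u u <= m * sqnorm u,
      forall u : 'rV_n.+1, bform A u u = m * sqnorm u -> u *m A = m *: u
    & exists2 u : 'rV_n.+1, u != 0 & u *m A = m *: u].
Proof.
have ev u a : u *m A = a *: u -> bform A u u = a * sqnorm u.
  by move=> h; rewrite /sqnorm /bform h mulmx1 -scalemxAl mxE.
have [u0 u0n0 hu0] : exists2 u : 'rV_n.+1, u != 0 & u *m A = mu *: u.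
  have /rowV0Pn [u /sub_kermxP hu u0] : kermx shift != 0.
    by rewrite kermx_eq0 row_free_unit shift_singular.
  exists u => //; move/eqP: hu.
  by rewrite /shift mulmxBr mul_mx_scalar subr_eq0 => /eqP.
exists mu; split=> //; last by exists u0.
- have eigmu : [set a : R | eigenvalue A a] mu by apply/eigenvalueP; exists u0.
  have ub : ubound [set a : R | eigenvalue A a] mu.
    move=> a /eigenvalueP [v hv v0].
    by rewrite -(ler_pM2r (x := sqnorm v)) ?sqnorm_gt0 // -(ev _ _ hv).
  apply/eqP; rewrite eq_le ub_le_sup ?ge_sup //; first by exists mu.
  by exists mu.
- move=> u hu; have b0 v : bform shift u v = 0.
    apply/eqP; rewrite -sqrf_eq0 eq_le sqr_ge0 andbT.
    apply: le_trans (psd_cauchy_schwarz u v shift_sym shift_psd) _.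
    by rewrite bform_scalarB -/(sqnorm u) hu subrr mul0r.
  apply/esym/eqP; rewrite -subr_eq0 -mul_mx_scalar -mulmxBr -/shift.
  apply/eqP/rowP => i; rewrite -bform1_delta mxE /= -(b0 (delta_mx 0 i)).
  by rewrite /bform mulmx1.
Qed.

End TopEigenvalue.

(** * The spectral radius of a graph *)

Section GraphSpectrum.
Local Open Scope ring_scope.
Variable R : realType.
Implicit Type G : sgraph.

Definition qform G (x : G -> R) : R := \sum_u \sum_(v | edge u v) x u * x v.
Definition sqsum G (x : G -> R) : R := \sum_u x u ^+ 2.

Lemma sqsum_gt0 G (x : G -> R) v : x v != 0 -> 0 < sqsum x.
Proof.
move=> xv; rewrite /sqsum (bigD1 v) //= ltr_pwDl ?exprn_even_gt0 //.
by rewrite sumr_ge0 // => i _; rewrite sqr_ge0.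
Qed.

(** The nonnegative eigenvector consists of the absolute values of an eigenvector: the norm is
    unchanged and the form does not drop, so the Rayleigh bound is attained and its equality case
    applies. *)
Lemma spectral_radius_spec G : (0 < #|G|)%N ->
  [/\ forall x : G -> R, qform x <= spectral_radius R G * sqsum x,
      forall x : G -> R, qform x = spectral_radius R G * sqsum x ->
        forall v, spectral_radius R G * x v = \sum_(u | edge v u) x u
    & exists x : G -> R, [/\ forall v, 0 <= x v, exists v, x v != 0
        & forall v, spectral_radius R G * x v = \sum_(u | edge v u) x u]].
Proof.
move=> G0; rewrite /spectral_radius; set A := adjmx R G.
have Asym : A^T = A by apply/matrixP => i j; rewrite !mxE edge_sym.
have [m [<- qle qeq [w w0 hw]]] : exists m : R,
  [/\ m = sup [set a : R | eigenvalue A a]%classic,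
      forall u : 'rV_#|G|, bform A u u <= m * sqnorm u,
      forall u : 'rV_#|G|, bform A u u = m * sqnorm u -> u *m A = m *: u
    & exists2 u : 'rV_#|G|, u != 0 & u *m A = m *: u].
  move: A Asym; case: #|G| G0 => // k _ A Asym.
  by have [m [-> h1 h2 h3]] := rayleigh_spectrum Asym; eexists; split.
pose row (x : G -> R) : 'rV[R]_#|G| := \row_i x (enum_val i).
have reidx (F : G -> R) : \sum_(i < #|G|) F (enum_val i) = \sum_u F u.
  rewrite [RHS](reindex (fun i : 'I_#|G| => enum_val i)) //.
  exact: (onW_bij _ (enum_val_bij G)).
have bq x : bform A (row x) (row x) = qform x.
  rewrite bformE /qform -reidx; apply: eq_bigr => i _.
  rewrite [RHS]big_mkcond -reidx; apply: eq_bigr => j _.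
  by rewrite !mxE; case: ifP => _; rewrite ?mulr1 // mulr0 mul0r.
have sq x : sqnorm (row x) = sqsum x.
  by rewrite sqnormE /sqsum -reidx; apply: eq_bigr => i _; rewrite mxE.
have eig x : row x *m A = m *: row x ->
    forall v, m * x v = \sum_(u | edge v u) x u.
  move=> /rowP h v; have := h (enum_rank v); rewrite !mxE enum_rankK => <-.
  rewrite [RHS]big_mkcond -reidx; apply: eq_bigr => i _.
  by rewrite !mxE enum_rankK edge_sym; case: ifP => _; rewrite ?mulr1 ?mulr0.
split=> [x|x hx|].
- by rewrite -bq -sq.
- by apply: eig; apply: qeq; rewrite bq hx sq.
have nonneg := qeq (row (fun v => `|w 0 (enum_rank v)|)).
exists (fun v => `|w 0 (enum_rank v)|); split=> [v||]; first exact: normr_ge0.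
  have /rV0Pn [i wi] := w0; exists (enum_val i).
  by rewrite enum_valK normr_eq0.
apply: eig; apply: nonneg; apply/eqP; rewrite eq_le qle /=.
have -> : sqnorm (row (fun v => `|w 0 (enum_rank v)|)) = sqnorm w.
  rewrite !sqnormE; apply: eq_bigr => i _.
  by rewrite mxE enum_valK real_normK // num_real.
have -> : m * sqnorm w = bform A w w.
  by rewrite /sqnorm /bform hw mulmx1 -scalemxAl [RHS]mxE.
rewrite !bformE; apply: ler_sum => i _; apply: ler_sum => j _.
rewrite !mxE !enum_valK; apply: le_trans (ler_norm _) _.
by rewrite !normrM normr_nat.
Qed.

Lemma spectral_radius_iso G H : (0 < #|G|)%N -> isomorphic G H ->
  spectral_radius R G = spectral_radius R H.
Proof.
move=> G0 [f [g fK gK] fE].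
have H0 : (0 < #|H|)%N by rewrite -(bij_eq_card (Bijective fK gK)).
have [le_G _ [x [_ [v xv] eigx]]] := spectral_radius_spec G0.
have [le_H _ [y [_ [w yw] eigy]]] := spectral_radius_spec H0.
have quad (K : sgraph) (z : K -> R) m :
    (forall v, m * z v = \sum_(u | edge v u) z u) -> qform z = m * sqsum z.
  move=> h; rewrite /qform /sqsum mulr_sumr; apply: eq_bigr => u _.
  by rewrite -mulr_sumr -h expr2 mulrCA.
have fbij : bijective f by exists g.
have tr (z : H -> R) : qform (z \o f) = qform z /\ sqsum (z \o f) = sqsum z.
  split; rewrite /qform /sqsum [RHS](reindex f (onW_bij _ fbij)) //.
  apply: eq_bigr => u _; rewrite [RHS](reindex f (onW_bij _ fbij)) //.
  by apply: eq_bigl => t; rewrite fE.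
apply/eqP; rewrite eq_le; apply/andP; split.
  have := le_H (x \o g); have [<- <-] := tr (x \o g).
  have -> : qform ((x \o g) \o f) = qform x.
    by apply: eq_bigr => u _; apply: eq_bigr => t _; rewrite /= !fK.
  have -> : sqsum ((x \o g) \o f) = sqsum x.
    by apply: eq_bigr => u _; rewrite /= fK.
  by rewrite (quad _ _ _ eigx) ler_pM2r ?(sqsum_gt0 xv).
have [qe se] := tr y; have := le_G (y \o f).
by rewrite qe se (quad _ _ _ eigy) ler_pM2r ?(sqsum_gt0 yw).
Qed.

End GraphSpectrum.

(** * Minors and branch sets *)

Section MinorModels.
Implicit Types G M H : sgraph.

Lemma minor_trans G M P : minor G M -> minor M P -> minor G P.
Proof.
move=> GM; elim=> {P} [|P v _ IH|P u v uv _ IH|P u v uv _ IH] //.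
- exact: minor_del_vertex.
- exact: minor_del_edge.
- exact: minor_contract.
Qed.

Definition induced_rel G (S : {set G}) : rel G :=
  fun a b => [&& edge a b, a \in S & b \in S].
Definition connected_set G (S : {set G}) : Prop :=
  {in S &, forall a b, connect (induced_rel S) a b}.

(* Branch sets of [H] in [G]: contracting each [B i] to a point and deleting   *)
(* the rest leaves a supergraph of [H].                                        *)
Definition minor_model H G (B : H -> {set G}) : Prop :=
  [/\ forall i, B i != set0,
      forall i, connected_set (B i),
      forall i j, i != j -> [disjoint B i & B j]
    & forall i j, edge i j -> exists a b, [/\ a \in B i, b \in B j & edge a b]].

Definition has_model H G : Prop := exists B, @minor_model H G B.

(** Edges may map to merely connected pairs, because a contraction collapses some edges to a
    point. *)
Lemma connect_homo (S T : finType) (e : rel S) (e' : rel T) (f : S -> T) :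
  (forall a b, e a b -> connect e' (f a) (f b)) ->
  forall a b, connect e a b -> connect e' (f a) (f b).
Proof.
move=> h a b /connectP [p]; elim: p a => [|c p IH] a /=; first by move=> _ ->.
by move=> /andP [ac cp] /(IH _ cp); apply: connect_trans; apply: h.
Qed.

Lemma model_del_vertex H G (B : H -> {set G}) v :
  minor_model B -> (forall i, v \notin B i) -> has_model H (del_vertex v).
Proof.
move=> [B0 Bc Bd Be] vB.
pose B' i : {set del_vertex v} := [set x | val x \in B i].
have nv i a : a \in B i -> a != v by apply: contraTneq => ->.
have up i a (ha : a \in B i) : (Sub a (nv i a ha) : del_vertex v) \in B' i.
  by rewrite inE.
exists B'; split.
- by move=> i; have /set0Pn [a ha] := B0 i; apply/set0Pn; eexists; apply: (up i a ha).
- move=> i x y; rewrite !inE => xi yi.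
  have := Bc i _ _ xi yi; pose pi a : del_vertex v := insubd x a.
  rewrite -[x in X in _ -> X](valKd x) -[y in X in _ -> X](valKd x).
  apply: (connect_homo (f := pi)) => a b /and3P [ab ai bi]; apply: connect1.
  by rewrite /induced_rel !inE /pi !val_insubd !(nv i) //= ai bi /edge /= /del_vertex_rel !val_insubd !(nv i) // ab.
- move=> i j /Bd dij; rewrite -setI_eq0; apply/eqP/setP => x; rewrite !inE.
  by case: (boolP (_ \in B i)) => // xi; rewrite (disjointFr dij xi).
- move=> i j /Be [a [b [ai bj ab]]].
  by exists (Sub a (nv i a ai)), (Sub b (nv j b bj)); rewrite !up.
Qed.

Lemma model_contract H G (B : H -> {set G}) i u v :
  minor_model B -> u \in B i -> v \in B i -> edge u v ->
  has_model H (contract u v).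
Proof.
move=> [B0 Bc Bd Be] ui vi uv.
have nuv : u != v by apply: contraTneq uv => ->; rewrite edge_irrefl.
pose pu : contract u v := Sub u nuv.
pose pi a : contract u v := insubd pu a.
have piv a : val (pi a) = if a != v then a else u by rewrite val_insubd.
pose B' j : {set contract u v} := [set pi a | a in B j].
(* Both ends of the contracted edge lie in [B i], so sending [v] to [u] changes membership in no
   branch set. *)
have same j a : (val (pi a) \in B j) = (a \in B j).
  rewrite piv; case: eqVneq => //= ->; have [->|ij] := eqVneq j i.
    by rewrite ui vi.
  have dij := Bd _ _ ij.
  by rewrite !(disjointFl dij).
have inB' j x : (x \in B' j) = (val x \in B j).
  apply/imsetP/idP => [[a aj ->]|xj]; first by rewrite same.
  by exists (val x) => //; rewrite /pi valKd.
have piE a b : edge a b -> (pi a == pi b) || edge (pi a) (pi b).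
  move=> ab; case: eqVneq => //= nab.
  rewrite /edge /= /contract_rel nab /= !piv.
  have [av|av] := eqVneq a v; have [bv|bv] := eqVneq b v => /=.
  - by move: ab; rewrite av bv edge_irrefl.
  - by rewrite eqxx -av ab !orbT.
  - by rewrite eqxx -bv [edge b a]edge_sym ab !orbT.
  - by rewrite ab.
exists B'; split.
- by move=> j; have /set0Pn [a aj] := B0 j; apply/set0Pn; exists (pi a); apply: imset_f.
- move=> j x y; rewrite !inB' => xj yj; have := Bc j _ _ xj yj.
  rewrite -[x in X in _ -> X](valKd pu) -[y in X in _ -> X](valKd pu).
  apply: (connect_homo (f := pi)) => a b /and3P [ab aj bj].
  have /orP [/eqP ->|e] := piE a b ab; first exact: connect0.
  by apply: connect1; rewrite /induced_rel e !inB' !same aj bj.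
- move=> j k /Bd djk; rewrite -setI_eq0; apply/eqP/setP => x.
  rewrite in_setI !inB' in_set0.
  by case: (boolP (_ \in B j)) => // xi; rewrite (disjointFr djk xi).
- move=> j k jk; have [a [b [aj bk ab]]] := Be j k jk.
  exists (pi a), (pi b); rewrite !inB' !same aj bk; split=> //.
  have /orP [/eqP e|//] := piE a b ab.
  have njk : j != k by apply: contraTneq jk => ->; rewrite edge_irrefl.
  by move: (same k b); rewrite -e same bk (disjointFr (Bd _ _ njk) aj).
Qed.

(** Induction on the number of edges of [G]: delete edges between images of non-adjacent vertices of
    [H] until [f] also reflects adjacency. *)
Lemma spanning_subgraph_minor H G (f : H -> G) :
  bijective f -> {homo f : x y / edge x y} ->
  exists2 M, minor G M & isomorphic M H.
Proof.
move=> fb fh; have [n] := ubnP #|[set p : G * G | edge p.1 p.2]|.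
elim: n => // n IH in G f fb fh * => le_n.
have [g fK gK] := fb.
have [/existsP [u /existsP [v /andP [uv nuv]]]|none] :=
    boolP [exists u, exists v, edge (f u) (f v) && ~~ edge u v].
  have [|||M GM MH] := IH (del_edge (f u) (f v)) f.
  - by exists g.
  - move=> x y xy; rewrite /edge /= /del_edge_rel fh //=.
    apply: contraNneq nuv => /setP e.
    have /(_ (f x)) := e; have /(_ (f y)) := e.
    rewrite !inE !eqxx ?orbT /= => /esym/orP hy /esym/orP hx.
    have nxy : x != y by apply: contraTneq xy => ->; rewrite edge_irrefl.
    case: hx hy => /eqP /(can_inj fK) hx [] /eqP /(can_inj fK) hy;
      move: xy nxy; rewrite hx hy ?eqxx // => xy _.
    by rewrite edge_sym.
  - rewrite ltnS in le_n; apply: leq_trans le_n; apply: proper_card.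
    apply/properP; split; first by apply/subsetP => p; rewrite !inE => /andP [].
    exists (f u, f v); rewrite !inE //= /edge /= /del_edge_rel eqxx andbF.
    by [].
  - exists M => //; apply: minor_trans GM; apply: minor_del_edge => //.
    exact: minor_refl.
exists G; first exact: minor_refl.
exists g; first by exists f.
move=> x y; apply/idP/idP => [|xy].
  by move/fh; rewrite !gK.
move: none; rewrite negb_exists => /forallP /(_ (g x)).
rewrite negb_exists => /forallP /(_ (g y)).
by rewrite !gK xy /= negbK.
Qed.

(** Induction on the number of vertices: delete a vertex covered by no branch set, or contract an
    edge inside one. When neither is possible, the branch sets are singletons covering [G], and [H]
    is a spanning subgraph. *)
Lemma model_minor H G : has_model H G -> exists2 M, minor G M & isomorphic M H.
Proof.
have [n] := ubnP #|G|; elim: n => // n IH in G * => le_n [B hB].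
have smaller (P : sgraph) : (#|P| < #|G|)%N -> minor G P -> has_model H P ->
    exists2 M, minor G M & isomorphic M H.
  move=> PG GP hP; have [|M PM MH] := IH P _ hP; first exact: leq_trans PG _.
  by exists M => //; apply: minor_trans PM.
have cardD (v : G) : (#|{: {x : G | x != v}}| < #|G|)%N.
  by rewrite card_sig -[X in (_ < X)%N](cardC (pred1 v)) card1 add1n ltnS; apply: eq_leq; apply: eq_card.
have [/existsP [v /forallP vB]|cov] := boolP [exists v, [forall i, v \notin B i]].
  apply: (smaller (del_vertex v)); rewrite ?cardD //.
    by apply: minor_del_vertex; apply: minor_refl.
  exact: model_del_vertex vB.
have [B0 Bc Bd Be] := hB.
have [/existsP [i /existsP [u /existsP [v /and3P [ui vi uv]]]]|sing] :=
    boolP [exists i, exists u, exists v, [&& u \in B i, v \in B i & edge u v]].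
  apply: (smaller (contract u v)); rewrite ?cardD //.
    by apply: minor_contract => //; apply: minor_refl.
  exact: model_contract hB ui vi uv.
have ex i : exists a, a \in B i by apply/set0Pn.
pose f i := xchoose (ex i); have fB i : f i \in B i := xchooseP (ex i).
(* A second vertex in a connected branch set would force an edge inside it. *)
have B1 i a : a \in B i -> a = f i.
  move=> ai; have /connectP [[|c p] /=] := Bc i _ _ ai (fB i); first by move=> _ ->.
  move=> /andP [/and3P [ac _ ci] _] _; case/negP: sing.
  by apply/existsP; exists i; apply/existsP; exists a; apply/existsP; exists c; rewrite ai ci.
apply: (@spanning_subgraph_minor H G f).
  have lab v : exists i, v \in B i.
    move: cov; rewrite negb_exists => /forallP /(_ v).
    by rewrite negb_forall => /existsP [i]; rewrite negbK; exists i.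
  exists (fun v => xchoose (lab v)) => [i|v]; last first.
    by rewrite -(B1 _ _ (xchooseP (lab v))).
  have h := xchooseP (lab (f i)); apply/eqP; apply: contraT => ne.
  by have := disjointFr (Bd _ _ ne) h; rewrite fB.
by move=> i j /Be [a [b [/B1 -> /B1 ->]]].
Qed.

Lemma minor_free_no_model H G : minor_free H G -> ~ has_model H G.
Proof. by move=> mf /model_minor. Qed.

End MinorModels.

(** * Dense graphs have complete minors *)

Section DenseMinors.
Implicit Types (G : sgraph).

Definition nbr G (v : G) : {set G} := [set u | edge v u].
(** Twice the number of edges induced on [S]. *)
Definition arcs G (S : {set G}) : nat := \sum_(u in S) #|nbr u :&: S|.
(** The neighbourhood of the new vertex when [U] is contracted inside [S]. *)
Definition boundary G (S U : {set G}) : {set G} :=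
  [set w in S :\: U | [exists u in U, edge u w]].

Lemma arcs_setD1 G (S : {set G}) w : w \in S ->
  arcs S = (arcs (S :\ w) + (#|nbr w :&: S|).*2)%N.
Proof.
move=> wS; rewrite /arcs (big_setD1 w) //= -addnn addnA addnC; congr addn.
have split_w u : u \in S :\ w ->
    #|nbr u :&: S| = (#|nbr u :&: (S :\ w)| + edge w u)%N.
  move=> _; rewrite (cardsD1 w (nbr u :&: S)) !inE wS andbT edge_sym addnC.
  by congr addn; apply: eq_card => v; rewrite !inE andbCA.
rewrite (eq_bigr _ split_w) big_split /=; congr addn.
rewrite -big_mkcondr sum1dep_card /=; apply: eq_card => v; rewrite !inE.
have [->|_] := eqVneq v w; first by rewrite edge_irrefl.
by rewrite andbC.
Qed.

Lemma connected_setU1 G (U : {set G}) u w :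
  connected_set U -> u \in U -> edge u w -> connected_set (w |: U).
Proof.
move=> cU uU uw.
have lift a b : a \in U -> b \in U -> connect (induced_rel (w |: U)) a b.
  move=> aU bU; have := cU _ _ aU bU; apply: connect_sub => c e.
  by case/and3P=> ce cU' eU; apply: connect1; rewrite /induced_rel ce !inE cU' eU !orbT.
have uw1 : connect (induced_rel (w |: U)) u w.
  by apply: connect1; rewrite /induced_rel uw !inE eqxx uU !orbT.
have wu1 : connect (induced_rel (w |: U)) w u.
  by apply: connect1; rewrite /induced_rel edge_sym uw !inE eqxx uU !orbT.
move=> a b; rewrite !inE => /orP [/eqP ->|aU] /orP [/eqP ->|bU].
- exact: connect0.
- by apply: connect_trans wu1 _; apply: lift.
- by apply: connect_trans uw1; apply: lift.
- exact: lift.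
Qed.

Lemma connected_set1 G (v : G) : connected_set [set v].
Proof. by move=> a b; rewrite !inE => /eqP -> /eqP ->; apply: connect0. Qed.

(** [U] becomes the branch set of the new vertex [ord0]: it is adjacent to every vertex of [T],
    hence to every [B i]. *)
Lemma cone_model G r (U T : {set G}) (B : 'I_r -> {set G}) :
  minor_model (B : complete r -> _) -> (forall i, B i \subset T) ->
  U != set0 -> connected_set U -> [disjoint U & T] ->
  (forall w, w \in T -> exists2 u, u \in U & edge u w) ->
  exists2 B' : 'I_r.+1 -> {set G}, minor_model (B' : complete r.+1 -> _)
    & forall i, B' i \subset U :|: T.
Proof.
move=> [B0 Bc Bd Be] BT U0 cU dUT adj.
pose B' (i : 'I_r.+1) := if unlift ord0 i is Some j then B j else U.
have UB j : exists a b, [/\ a \in U, b \in B j & edge a b].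
  have /set0Pn [b bj] := B0 j; have [u uU ub] := adj b (subsetP (BT j) _ bj).
  by exists u, b.
have dUB j : [disjoint U & B j] by apply: disjointWr dUT.
exists B'; last first.
  move=> i; rewrite /B'; case: unliftP => [j _|_]; last exact: subsetUl.
  by rewrite (subset_trans (BT j)) // subsetUr.
split.
- by move=> i; rewrite /B'; case: unliftP.
- by move=> i; rewrite /B'; case: unliftP.
- move=> i j; rewrite /B'; case: unliftP => [i' ->|->]; case: unliftP => [j' ->|->] //.
  + by rewrite (inj_eq (@lift_inj _ _)) => /Bd.
  + by rewrite disjoint_sym.
- move=> i j; rewrite /B'; case: unliftP => [i' ->|->]; case: unliftP => [j' ->|->] //.
  + by rewrite /edge /= (inj_eq (@lift_inj _ _)) => /(Be i' j').
  + move=> _; have [a [b [aU bj ab]]] := UB i'.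
    by exists b, a; rewrite edge_sym.
Qed.

(* Grow a connected [U] as long as contracting it to a point keeps the density *)
(* [2 ^ r.+1]; when this is no longer possible, every vertex of the boundary   *)
(* of [U] has [2 ^ r] neighbours in the boundary.                              *)
Lemma dense_complete_model G r (S : {set G}) :
  S != set0 -> 2 ^ r * #|S| <= arcs S ->
  exists2 B : 'I_r.+1 -> {set G}, minor_model (B : complete r.+1 -> _)
    & forall i, B i \subset S.
Proof.
elim: r S => [|r IHr] S.
  move=> /set0Pn [v vS] _; exists (fun=> [set v]); last by move=> i; rewrite sub1set.
  split=> [i|i|i j|i j].
  - by apply/set0Pn; exists v; rewrite inE.
  - exact: connected_set1.
  - by rewrite !ord1.
  - by rewrite !ord1 edge_irrefl.
have [n] := ubnP #|S|; elim: n => // n IHn in S *.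
move=> le_n S0 dS.
(* The last premise is the density of the graph on [S] with [U] contracted: it has [(#|S :\: U|).+1]
   vertices, and the boundary accounts for the arcs at the contracted vertex. *)
suff grow U : U != set0 -> U \subset S -> connected_set U ->
    2 ^ r.+1 * (#|S :\: U|).+1 <= arcs (S :\: U) + (#|boundary S U|).*2 ->
    exists2 B : 'I_r.+2 -> {set G}, minor_model (B : complete r.+2 -> _)
      & forall i, B i \subset S.
  have /set0Pn [v vS] := S0; apply: (grow [set v]).
  - by apply/set0Pn; exists v; rewrite inE.
  - by rewrite sub1set.
  - exact: connected_set1.
  have := dS; rewrite (cardsD1 v) vS (arcs_setD1 vS) add1n.
  suff -> : nbr v :&: S = boundary S [set v] by [].
  apply/setP => w; rewrite !inE.
  have -> : [exists u in [set v], edge u w] = edge v w.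
    apply/existsP/idP => [[u]|vw]; first by rewrite inE => /andP [/eqP ->].
    by exists v; rewrite inE eqxx.
  have [->|_] := eqVneq w v; first by rewrite edge_irrefl andbF.
  by rewrite andbC.
have [k] := ubnP #|S :\: U|; elim: k => // k IHk in U *.
move=> le_k U0 US cU dU.
have [/existsP [w /andP [wN dw]]|stuck] := boolP [exists w, (w \in boundary S U) &&
    (2 ^ r.+1 * (#|S :\: (w |: U)|).+1 <=
       arcs (S :\: (w |: U)) + (#|boundary S (w |: U)|).*2)].
  move: wN; rewrite inE => /andP [wSU /existsP [u /andP [uU uw]]].
  have [wU wS] := setDP wSU.
  apply: (IHk (w |: U)) => //.
  - rewrite ltnS in le_k; apply: leq_trans le_k; apply: proper_card.
    apply/properP; split; last by exists w => //; rewrite !inE eqxx.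
    by apply: setDS; apply: subsetUr.
  - by apply/set0Pn; exists w; rewrite !inE eqxx.
  - by rewrite subUset sub1set wU.
  - exact: connected_setU1 uU uw.
(* With an empty boundary all arcs lie in [S :\: U], which is smaller than [S], and the outer
   induction applies. *)
have [N0|Nn0] := eqVneq (boundary S U) set0.
  have e : exists2 B : 'I_r.+2 -> {set G}, minor_model (B : complete r.+2 -> _)
      & forall i, B i \subset S :\: U.
    move: dU; rewrite N0 cards0 addn0 => dU; apply: IHn.
    - rewrite ltnS in le_n; apply: leq_trans le_n; apply: proper_card.
      have /set0Pn [u uU] := U0.
      apply/properP; split; first exact: subsetDl.
      by exists u; [apply: (subsetP US)|rewrite !inE uU].
    - apply: contraTneq dU => ->; rewrite /arcs big_set0 -ltnNge.
      by rewrite muln_gt0 expn_gt0.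
    - by apply: leq_trans dU; rewrite leq_mul2l leqnSn orbT.
  by have [B hB BS] := e; exists B => // i; apply: subset_trans (BS i) (subsetDl _ _).
(* Absorbing [w] costs one vertex and at most the following edges: the one joining it to the
   contracted vertex, and one for each neighbour of [w] in the boundary. As this breaks the density
   bound, there are at least [2 ^ r] such neighbours. *)
have degN w : w \in boundary S U -> 2 ^ r <= #|nbr w :&: boundary S U|.
  move=> wN; move: stuck; rewrite negb_exists => /forallP /(_ w).
  rewrite wN /= -ltnNge => lt.
  have wSU : w \in S :\: U by move: wN; rewrite inE => /andP [].
  have eD : S :\: (w |: U) = (S :\: U) :\ w.
    by apply/setP => x; rewrite !inE negb_or andbA.
  rewrite eD in lt.
  move: dU; rewrite (arcs_setD1 wSU) (cardsD1 w (S :\: U)) wSU add1n => dU.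
  have cN : #|nbr w :&: (S :\: U)| + #|boundary S U| <=
      #|boundary S (w |: U)| + #|nbr w :&: boundary S U| + 1.
    have -> : boundary S U = w |: (boundary S U :\ w) by rewrite setD1K.
    have -> : nbr w :&: (w |: (boundary S U :\ w)) = nbr w :&: (boundary S U :\ w).
      apply/setP => x; rewrite !inE; case: eqVneq => // ->.
      by rewrite edge_irrefl.
    rewrite cardsU1 !inE eqxx /= add1n addnS addn1 ltnS -cardsUI.
    apply: leq_add; apply: subset_leq_card; apply/subsetP => x; rewrite !inE.
      move=> /orP [/and3P [wx nxU xS]|].
        have nxw : x != w by apply: contraTneq wx => ->; rewrite edge_irrefl.
        rewrite negb_or nxw nxU xS /=; apply/existsP; exists w.
        by rewrite !inE eqxx.
      case/andP => xw /andP [/andP [nxU ->] /existsP [u /andP [uU ux]]].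
      rewrite negb_or xw nxU /=; apply/existsP; exists u.
      by rewrite !inE uU orbT.
    by case/andP => /and3P [-> _ _] ->.
  rewrite expnS in lt dU; move: lt dU cN.
  set a := #|_ :\ w|; set e := arcs _; set p := #|boundary S (w |: U)|.
  set q := #|nbr w :&: boundary S U|; set x := #|nbr w :&: (S :\: U)|.
  set y := #|boundary S U|; set D := 2 ^ r.
  clearbody a e p q x y D => lt dU cN.
  move: lt dU; rewrite !mulnS -!mulnA -!muln2; set z := (D * a)%N; lia.
have [|B hB BN] := IHr (boundary S U) Nn0.
  rewrite /arcs mulnC -sum_nat_const; apply: leq_sum => w wN.
  exact: degN.
have NSU : boundary S U \subset S :\: U by apply/subsetP => w; rewrite inE => /andP [].
have [||B' hB' B'S] := cone_model hB BN U0 cU.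
- rewrite disjoint_sym; apply: disjointWl NSU _.
  by rewrite -setI_eq0; apply/eqP/setP => w; rewrite !inE; case: (w \in U); rewrite ?andbF.
- by move=> w; rewrite inE => /andP [_ /existsP [u /andP [uU uw]]]; exists u.
exists B' => // i; apply: subset_trans (B'S i) _.
by rewrite subUset US; apply: subset_trans NSU (subsetDl _ _).
Qed.

End DenseMinors.

(** * Minors from bicliques *)

Section HubModels.
Implicit Types (G H : sgraph).

Lemma set_injection (S T : finType) (A : {set S}) (B : {set T}) (d : S -> T) :
  #|A| <= #|B| ->
  exists f : S -> T, {in A, forall x, f x \in B} /\ {in A &, injective f}.
Proof.
move=> le_AB; exists (fun x => nth (d x) (enum B) (index x (enum A))).
have idx x : x \in A -> index x (enum A) < size (enum B).
  by rewrite -cardE => xA; apply: leq_trans le_AB; rewrite cardE index_mem mem_enum.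
split=> [x xA|x y xA yA]; first by rewrite -mem_enum mem_nth ?idx.
rewrite (set_nth_default (d x)) ?idx // => /eqP.
rewrite nth_uniq ?idx ?enum_uniq // => /eqP e.
by rewrite -(nth_index x (s := enum A) (x := x)) ?mem_enum // e nth_index ?mem_enum.
Qed.

(* Outside [Q] the branch sets are pairs made of a hub in [X] and a private    *)
(* vertex of [Y], which makes the hubs pairwise adjacent.                      *)
Lemma hub_model H G (X Y : {set G}) (Q : {set H}) (f : H -> G) :
  (forall x y, x \in X -> y \in Y -> edge x y) ->
  #|~: Q| <= #|X| -> #|H| <= #|Y| ->
  {in Q, forall i, f i \in Y} -> {in Q &, injective f} ->
  {in Q &, {homo f : i j / edge i j}} -> has_model H G.
Proof.
move=> XY QX HY fY finj fe.
have [h [hX hinj]] := set_injection f QX.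
have [|g [gY ginj]] := @set_injection _ _ (~: Q) (Y :\: f @: Q) f.
  have fQY : f @: Q \subset Y by apply/subsetP => _ /imsetP [i iQ ->]; apply: fY.
  rewrite cardsD (setIidPr fQY) card_in_imset //.
  by have := cardsC Q; lia.
have nXY x : x \in X -> x \in Y -> False.
  by move=> xX xY; have := XY x x xX xY; rewrite edge_irrefl.
have gP i : i \notin Q -> [/\ h i \in X, g i \in Y & forall j, j \in Q -> g i != f j].
  move=> iQ; have iQ' : i \in ~: Q by rewrite inE.
  have := gY i iQ'; rewrite inE => /andP [nf giY]; split=> //; first exact: hX.
  by move=> j jQ; apply: contraNneq nf => ->; apply: imset_f.
pose B i := if i \in Q then [set f i] else [set h i; g i].
exists B; split=> [i|i|i j ij|i j ij]; rewrite /B.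
- by apply/set0Pn; case: ifP => _; [exists (f i)|exists (h i)]; rewrite !inE eqxx.
- case: ifPn => [_|/gP [hi gi _]]; first exact: connected_set1.
  rewrite setUC; apply: (@connected_setU1 _ _ (h i)); rewrite ?inE ?XY //.
  exact: connected_set1.
- rewrite -setI_eq0; apply/eqP/setP => x; rewrite in_set0; apply/negP.
  case: ifPn => iQ; case: ifPn => jQ; rewrite !inE.
  + by case/andP => /eqP -> /eqP /finj e; rewrite e ?eqxx in ij.
  + have [hj gj nj] := gP j jQ.
    case/andP => /eqP -> /orP [] /eqP e; last by have := nj i iQ; rewrite e eqxx.
    by apply: (nXY (h j)) => //; rewrite -e fY.
  + have [hi gi ni] := gP i iQ.
    case/andP => /orP [] /eqP -> /eqP e; last by have := ni j jQ; rewrite e eqxx.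
    by apply: (nXY (h i)) => //; rewrite e fY.
  + have [hi gi _] := gP i iQ; have [hj gj _] := gP j jQ.
    have iQ' : i \in ~: Q by rewrite inE.
    have jQ' : j \in ~: Q by rewrite inE.
    case/andP => /orP [] /eqP -> /orP [] /eqP e.
    * by rewrite (hinj _ _ iQ' jQ' e) eqxx in ij.
    * by apply: (nXY (h i)) => //; rewrite e.
    * by apply: (nXY (h j)) => //; rewrite -e.
    * by rewrite (ginj _ _ iQ' jQ' e) eqxx in ij.
- case: ifPn => iQ; case: ifPn => jQ.
  + by exists (f i), (f j); rewrite !inE !eqxx fe.
  + have [hj gj _] := gP j jQ; exists (f i), (h j).
    by rewrite !inE !eqxx edge_sym XY ?fY.
  + have [hi gi _] := gP i iQ; exists (h i), (f j).
    by rewrite !inE !eqxx XY ?fY.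
  + have [hi gi _] := gP i iQ; have [hj gj _] := gP j jQ.
    by exists (h i), (g j); rewrite !inE !eqxx ?orbT XY.
Qed.

(** The non-adjacent pair [a], [b] can go to any two vertices of [Y], so [#|H| - 2] hubs suffice. *)
Lemma biclique_model H G (X Y : {set G}) (a b : H) :
  (forall x y, x \in X -> y \in Y -> edge x y) ->
  a != b -> ~~ edge a b -> #|H| <= #|X| + 2 -> 2 <= #|H| <= #|Y| -> has_model H G.
Proof.
move=> XY nab eab HX /andP [H2 HY].
have [u [v [uY vY nuv]]] : exists u v, [/\ u \in Y, v \in Y & u != v].
  have /card_gt1P [u [v [uY vY uv]]] : 1 < #|Y| by apply: leq_trans HY.
  by exists u, v.
apply: (@hub_model _ _ X Y [set a; b] (fun i => if i == a then u else v)) => //.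
- by rewrite cardsCs setCK cards2 nab leq_subLR addnC.
- by move=> i _; case: ifP.
- move=> i j; rewrite !inE => /orP [] /eqP -> /orP [] /eqP -> //;
    rewrite ?eqxx ?[b == a]eq_sym ?(negPf nab) //; move/eqP.
    by rewrite (negPf nuv).
  by rewrite eq_sym (negPf nuv).
- move=> i j; rewrite !inE => /orP [] /eqP -> /orP [] /eqP ->;
    rewrite ?edge_irrefl ?[edge b a]edge_sym ?(negPf eab) //.
Qed.

(** A third vertex placed directly in [Y] saves one more hub. As [ab] is missing, only [ac] and [bc]
    may have to be realized, by [uw] and [vw]. *)
Lemma biclique3_model H G (X Y : {set G}) (a b c : H) u v w :
  (forall x y, x \in X -> y \in Y -> edge x y) ->
  uniq [:: a; b; c] -> ~~ edge a b -> #|H| <= #|X| + 3 -> #|H| <= #|Y| ->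
  {subset [:: u; v; w] <= Y} -> uniq [:: u; v; w] ->
  edge u w -> (edge b c -> edge v w) -> has_model H G.
Proof.
move=> XY /and3P []; rewrite !inE negb_or => /andP [nab nac] nbc _ eab HX HY.
move=> sub /and3P []; rewrite !inE negb_or => /andP [nuv nuw] nvw _ uw vw.
pose f i := if i == a then u else if i == b then v else w.
have [fa fb fc] : [/\ f a = u, f b = v & f c = w].
  rewrite /f !eqxx [b == a]eq_sym [c == a]eq_sym [c == b]eq_sym.
  by rewrite (negPf nab) (negPf nac) (negPf nbc).
apply: (@hub_model _ _ X Y [set i in [:: a; b; c]] f) => //.
- rewrite cardsCs setCK cardsE (card_uniqP _); last first.
    by rewrite /= !inE negb_or nab nac nbc.
  by rewrite leq_subLR addnC.
- move=> i; rewrite !inE => /or3P [] /eqP ->; apply: sub;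
    by rewrite ?fa ?fb ?fc !inE eqxx ?orbT.
- move=> i j; rewrite !inE => /or3P [] /eqP -> /or3P [] /eqP ->;
    rewrite ?fa ?fb ?fc // => /eqP; rewrite 1?eq_sym ?(negPf nuv) ?(negPf nuw) ?(negPf nvw) //;
    by rewrite 1?eq_sym ?(negPf nuv) ?(negPf nuw) ?(negPf nvw).
- move=> i j; rewrite !inE => /or3P [] /eqP -> /or3P [] /eqP ->;
    rewrite ?fa ?fb ?fc ?edge_irrefl ?(negPf eab) // => e.
  + by rewrite edge_sym (negPf eab) in e.
  + by rewrite edge_sym.
  + by rewrite edge_sym vw // edge_sym.
Qed.

End HubModels.

(** * Walk counts for a Perron vector *)

Section Profiles.
Local Open Scope ring_scope.
Variable R : realType.

(* The bound [rho_large] says that [rho] is at least the spectral radius of    *)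
(* K_{t,n-t}.                                                                  *)
Record profile (t D r : nat) (G : sgraph) := Profile {
  rho : R;
  vec : G -> R;
  top : G;
  rho_ge0 : 0 <= rho;
  vec_ge0 : forall v, 0 <= vec v;
  vec_le1 : forall v, vec v <= 1;
  vec_top : vec top = 1;
  vec_eigen : forall v, rho * vec v = \sum_(u | edge v u) vec u;
  rho_large : t%:R * (#|G|%:R - t%:R) <= rho ^+ 2;
  arcs_le : forall S : {set G}, (arcs S <= D * #|S|)%N;
  no_biclique : forall X Y : {set G},
    (forall a b, a \in X -> b \in Y -> edge a b) -> (t < #|X|)%N -> (#|Y| < r)%N
}.

Variables (t D r : nat) (G : sgraph) (p : profile t D r G).
Local Notation x := (vec p).
Local Notation m := (rho p).
Local Notation deg v := (#|nbr v|%:R : R).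
Local Notation n := (#|G|%:R : R).
Implicit Types (S : {set G}) (u v w : G).

Definition large (e : R) : {set G} := [set v | e <= x v].

Lemma sum_deg_le S : \sum_(v in S) deg v <= D%:R * n.
Proof.
rewrite -natr_sum -natrM ler_nat.
apply: leq_trans (_ : arcs [set: G] <= _)%N; last first.
  by have := arcs_le p setT; rewrite cardsT.
rewrite /arcs [X in (_ <= X)%N](bigID (mem S)) /=.
apply: leq_trans (leq_addr _ _); apply: eq_leq.
by apply: eq_big => v; rewrite ?inE ?setIT.
Qed.

Lemma nbr_sum v (F : G -> R) : \sum_(u | edge v u) F u = \sum_(u in nbr v) F u.
Proof. by apply: eq_bigl => u; rewrite inE. Qed.

Lemma sum_const_nbr v (c : R) : \sum_(u | edge v u) c = c * deg v.
Proof. by rewrite nbr_sum sumr_const mulr_natr. Qed.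

(** By the eigenvalue equation a large vertex has degree at least [m * e], entries being at most 1;
    sparsity bounds the degree sum. *)
Lemma card_large_le e : 0 <= e -> m * e * #|large e|%:R <= D%:R * n.
Proof.
move=> e0; apply: le_trans (sum_deg_le (large e)).
rewrite mulr_natr -sumr_const; apply: ler_sum => v; rewrite inE => ev.
apply: le_trans (ler_wpM2l (rho_ge0 p) ev) _.
rewrite vec_eigen -[deg v]mul1r -sum_const_nbr; apply: ler_sum => u _.
exact: vec_le1.
Qed.

(** The eigenvalue equation applied twice writes [m ^ 2 * x v] as a sum over 2-walks from [v]. Those
    ending outside [S] weigh at most [e] each and are no more numerous than the arcs of [G]. *)
Lemma two_walks S e v : 0 <= e -> (forall w, w \notin S -> x w <= e) ->
  m ^+ 2 * x v <=
    \sum_(u | edge v u) \sum_(w in S | edge u w) x w + e * (D%:R * n).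
Proof.
move=> e0 hS; rewrite expr2 -mulrA vec_eigen mulr_sumr.
apply: le_trans (_ : \sum_(u | edge v u)
    (\sum_(w in S | edge u w) x w + e * deg u) <= _).
  apply: ler_sum => u _; rewrite vec_eigen (bigID (mem S)) /=.
  under eq_bigl do rewrite andbC.
  rewrite lerD2l -sum_const_nbr [X in _ <= X](bigID (mem S)) /=.
  rewrite ler_wpDl ?sumr_ge0 //.
  by apply: ler_sum => w /andP [_ /hS].
rewrite big_split /= lerD2l -mulr_sumr ler_wpM2l //.
by rewrite nbr_sum sum_deg_le.
Qed.

(** The second steps of 2-walks from [v] to large vertices are arcs inside [nbr v :|: large e],
    whose number sparsity controls. *)
Lemma large_deg_crude e v : 0 <= e ->
  m ^+ 2 * x v <= D%:R * deg v + D%:R * #|large e|%:R + e * (D%:R * n).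
Proof.
move=> e0; have hS w : w \notin large e -> x w <= e.
  by rewrite inE -ltNge => /ltW.
apply: le_trans (two_walks v e0 hS) _; rewrite lerD2r.
set S := large e.
apply: le_trans (_ : (\sum_(u in nbr v) #|nbr u :&: S|)%:R <= _).
  rewrite natr_sum nbr_sum; apply: ler_sum => u _.
  rewrite -sumr_const; apply: le_trans (_ : \sum_(w in S | edge u w) 1 <= _).
    by apply: ler_sum => w _; apply: vec_le1.
  rewrite le_eqVlt; apply/orP; left; apply/eqP.
  by apply: eq_bigl => w; rewrite !inE andbC.
rewrite -mulrDr -natrD -natrM ler_nat.
apply: leq_trans (_ : arcs (nbr v :|: S) <= _)%N; last first.
  apply: leq_trans (arcs_le p _) _; rewrite leq_mul2l cardsU.
  by rewrite leq_subr orbT.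
rewrite /arcs [X in (_ <= X)%N](bigID (mem (nbr v))) /=.
apply: leq_trans (leq_addr _ _).
rewrite [X in (_ <= X)%N](eq_bigl (mem (nbr v))); last first.
  by move=> u; rewrite !inE; case: (edge v u); rewrite ?andbF.
apply: leq_sum => u _; apply: subset_leq_card.
by apply: setIS; apply: subsetUr.
Qed.

(** Group the vertices by their trace on [S]: a trace of more than [t] vertices is shared by fewer
    than [r] vertices, by [no_biclique]. *)
Lemma card_bad_le S : (#|[set u | t < #|nbr u :&: S|]| <= r * 2 ^ #|S|)%N.
Proof.
set Bad := [set u | _].
rewrite -card_powerset mulnC -sum_nat_const -sum1_card.
rewrite (partition_big (fun u => nbr u :&: S) (mem (powerset S))) /=; last first.
  by move=> u _; rewrite inE subsetIr.
apply: leq_sum => X _; rewrite sum1dep_card.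
have [tX|Xt] := ltnP t #|X|.
  apply: ltnW; apply: (no_biclique p (X := X)) => // a b aX.
  rewrite inE => /andP [_ /eqP e]; move: aX; rewrite -e !inE edge_sym.
  by case/andP.
rewrite eq_card0 // => u; rewrite !inE.
by case: eqP => [->|_]; rewrite ?andbF // ltnNge Xt.
Qed.

(** A middle vertex contributes at most [t], or at most [#|S|] if it is one of the few bad ones.
    Each middle vertex adjacent to [w] falls short of this by at least [1 - x w], which is kept on
    the left. *)
Lemma two_walks_tight S e v w : 0 <= e -> (forall a, a \notin S -> x a <= e) ->
  w \in S ->
  m ^+ 2 * x v + (1 - x w) * #|nbr v :&: nbr w|%:R <=
    t%:R * deg v + (r * 2 ^ #|S| * #|S|)%:R + e * (D%:R * n).
Proof.
move=> e0 hS wS; have := two_walks v e0 hS.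
set P := \sum_(u | edge v u) _ => h.
suff : P + (1 - x w) * #|nbr v :&: nbr w|%:R <=
    t%:R * deg v + (r * 2 ^ #|S| * #|S|)%:R by lra.
pose Bad := [set u | (t < #|nbr u :&: S|)%N].
have -> : (1 - x w) * #|nbr v :&: nbr w|%:R =
    \sum_(u | edge v u) (if edge u w then 1 - x w else 0).
  rewrite -big_mkcondr sumr_const mulr_natr; congr (_ *+ _).
  by apply: eq_card => u; rewrite !inE unfold_in [edge w u]edge_sym.
rewrite -big_split /=.
apply: le_trans (_ : \sum_(u | edge v u)
    (t%:R + (if u \in Bad then #|S|%:R else 0)) <= _).
  apply: ler_sum => u _.
  apply: le_trans (_ : #|nbr u :&: S|%:R <= _); last first.
    case: ifPn => [_|]; last by rewrite inE -leqNgt addr0 ler_nat.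
    rewrite -natrD ler_nat; apply: leq_trans (leq_addl _ _).
    exact: subset_leq_card (subsetIr _ _).
  have -> : #|nbr u :&: S|%:R = \sum_(a in S | edge u a) 1 :> R.
    by rewrite -sumr_const; apply: eq_bigl => a; rewrite !inE andbC.
  case: ifP => uw; last first.
    by rewrite addr0; apply: ler_sum => a _; apply: vec_le1.
  rewrite (bigD1 w) ?wS //= [X in _ <= X](bigD1 w) ?wS //=.
  have : \sum_(i | (i \in S) && edge u i && (i != w)) x i <=
         \sum_(i | (i \in S) && edge u i && (i != w)) 1.
    by apply: ler_sum => a _; apply: vec_le1.
  lra.
rewrite big_split /= sum_const_nbr lerD2l -big_mkcondr sumr_const -mulrnA.
rewrite ler_nat mulnC leq_mul2r; apply/orP; right.
apply: leq_trans (card_bad_le S); apply: subset_leq_card.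
by apply/subsetP => u; rewrite unfold_in => /andP [].
Qed.

End Profiles.

(** * The vertices with large entries *)

Section Asymptotics.
Local Open Scope ring_scope.
Variable R : realType.
Variables (t D r : nat).
Hypotheses (t_gt0 : (0 < t)%N) (D_gt0 : (0 < D)%N).
Implicit Types (G : sgraph).


Lemma eventually_ge (K : R) : exists N, forall k : nat, (N <= k)%N -> K <= k%:R.
Proof.
exists (Num.bound `|K|) => k hk; apply: le_trans (ler_norm K) _.
by apply: ltW; apply: lt_le_trans (archi_boundP (normr_ge0 K)) _; rewrite ler_nat.
Qed.

Lemma large_deg_linear (e : R) : 0 < e -> exists2 c : R, 0 < c &
  exists N, forall G (p : profile R t D r G) v, (N <= #|G|)%N ->
    e <= vec p v -> c * #|G|%:R <= #|nbr v|%:R.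
Proof.
have D0 : 0 < D%:R :> R by rewrite ltr0n.
have t1 : 1 <= t%:R :> R by rewrite ler1n.
move=> e0; exists (e / (4 * D%:R)); first by rewrite divr_gt0 ?mulr_gt0.
(* Chosen so that the two error terms of [large_deg_crude] are at most [e * n / 8] each. Since
   [m ^ 2 >= n / 2], this leaves [e * n / 4] for [D * deg v]; [K] is the lower bound on [m] that
   makes the vertices above [e'] few enough. *)
pose e' := e / (8 * D%:R); pose K := 64 * D%:R ^+ 3 / e ^+ 2 : R.
have e'0 : 0 < e' by rewrite divr_gt0 ?mulr_gt0.
have K0 : 0 < K by rewrite divr_gt0 ?mulr_gt0 ?exprn_gt0.
have [N1 hN1] := eventually_ge (2 * K ^+ 2).
have [N2 hN2] := eventually_ge (2 * t%:R).
exists (maxn N1 N2) => G p v; rewrite geq_max => /andP [/hN1 nK /hN2 nt] ev.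
set n := #|G|%:R in nK nt *; set m := rho p.
have m2 : n / 2 <= m ^+ 2.
  apply: le_trans (rho_large p); rewrite -/n.
  have : 0 <= (t%:R - 1) * (n - t%:R) by rewrite mulr_ge0 //; lra.
  lra.
have mK : K <= m.
  rewrite -(ler_pXn2r (n := 2)) // ?nnegrE ?(ltW K0) ?rho_ge0 //; lra.
have cL := card_large_le p (ltW e'0); rewrite -/m -/n in cL.
set l := #|large p e'|%:R in cL.
have l0 : 0 <= l by rewrite ler0n.
have l8 : 8 * D%:R * l <= e * n.
  have : K * e' * l <= D%:R * n.
    by apply: le_trans cL; rewrite !ler_wpM2r // ltW.
  have -> : K * e' * l = (8 * D%:R * l) * (D%:R / e).
    by rewrite /K /e'; field; rewrite !gt_eqF.
  move=> h; rewrite -(ler_pM2r (x := D%:R / e)) ?divr_gt0 //.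
  by have -> : e * n * (D%:R / e) = D%:R * n by field; rewrite gt_eqF.
have := large_deg_crude p v (ltW e'0); rewrite -/m -/n -/l.
have mx : n / 2 * e <= m ^+ 2 * vec p v.
  apply: ler_pM => //; [lra|exact: ltW].
have -> : e' * (D%:R * n) = e * n / 8 by rewrite /e'; field; rewrite gt_eqF.
set d := #|nbr v|%:R => h.
have -> : e / (4 * D%:R) * n = (e * n / 4) / D%:R by field; rewrite gt_eqF.
rewrite ler_pdivrMr // mulrC; lra.
Qed.

Lemma card_large_bounded (e : R) : 0 < e ->
  exists M N, forall G (p : profile R t D r G), (N <= #|G|)%N ->
    (#|large p e| <= M)%N.
Proof.
move=> e0; have [c c0 [N hN]] := large_deg_linear e0.
exists (Num.bound (D%:R / c)), (maxn N 1) => G p.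
rewrite geq_max => /andP [nN n1].
have n0 : 0 < #|G|%:R :> R by rewrite ltr0n.
have : \sum_(v in large p e) c * #|G|%:R <= D%:R * #|G|%:R.
  apply: le_trans (sum_deg_le p (large p e)); apply: ler_sum => v.
  by rewrite inE; apply: hN.
rewrite sumr_const -[c * _ *+ _]mulr_natr mulrAC ler_pM2r // mulrC -ler_pdivlMr // => h.
rewrite -(ler_nat R); apply: le_trans h _; apply: ltW; apply: archi_boundP.
by rewrite divr_ge0 // ltW.
Qed.

(** This is [two_walks_tight] for a set [S] of bounded size, where all errors are absorbed in
    [d * n]. *)
Lemma deg_codeg (d : R) : 0 < d -> exists N, forall G (p : profile R t D r G) v w,
  (N <= #|G|)%N -> d <= vec p w ->
  t%:R * #|G|%:R * vec p v + (1 - vec p w) * #|nbr v :&: nbr w|%:R <=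
    t%:R * #|nbr v|%:R + d * #|G|%:R.
Proof.
have D0 : 0 < D%:R :> R by rewrite ltr0n.
have D1 : 1 <= D%:R :> R by rewrite ler1n.
move=> d0; pose e := d / (2 * D%:R).
have e0 : 0 < e by rewrite divr_gt0 // mulr_gt0.
have [M [N1 hM]] := card_large_bounded e0.
(* The errors of constant size: the bad vertices, and the loss [t ^ 2] in [rho_large]. *)
pose K : R := (r * 2 ^ M * M)%:R + t%:R ^+ 2.
have [N2 hN2] := eventually_ge (2 * K / d).
exists (maxn N1 N2) => G p v w; rewrite geq_max => /andP [nN1 /hN2 nK] dw.
have lM := hM G p nN1.
have wL : w \in large p e.
  rewrite inE; apply: le_trans dw; rewrite /e ler_pdivrMr ?mulr_gt0 //; nra.
have hS a : a \notin large p e -> vec p a <= e by rewrite inE -ltNge => /ltW.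
have := two_walks_tight v (ltW e0) hS wL.
set n := #|G|%:R in nK *.
have -> : e * (D%:R * n) = d * n / 2 by rewrite /e; field; rewrite gt_eqF.
have kM : (r * 2 ^ #|large p e| * #|large p e|)%:R <= (r * 2 ^ M * M)%:R :> R.
  by rewrite ler_nat !leq_mul // leq_pexp2l.
have mx : t%:R * (n - t%:R) * vec p v <= rho p ^+ 2 * vec p v.
  by rewrite ler_wpM2r ?vec_ge0 ?rho_large.
have tx : t%:R ^+ 2 * vec p v <= t%:R ^+ 2.
  by rewrite ler_piMr ?vec_le1 // exprn_ge0.
have Kn : K <= d * n / 2.
  by move: nK; rewrite ler_pdivrMr // => nK; lra.
rewrite /K in Kn; lra.
Qed.

Definition common_nbr G (X : {set G}) : {set G} := [set u | [forall w in X, edge w u]].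

Lemma card_common_nbr G (X : {set G}) :
  (#|G| <= #|common_nbr X| + \sum_(w in X) #|~: nbr w|)%N.
Proof.
rewrite -(cardsC (common_nbr X)) leq_add2l.
rewrite -sum1_card; under [X in (_ <= X)%N]eq_bigr do rewrite -sum1_card big_mkcond /=.
rewrite exchange_big big_mkcond /=; apply: leq_sum => u _.
rewrite !inE; case: ifP => //; rewrite negb_forall => /existsP [w].
by rewrite negb_imply => /andP [wX wu]; rewrite (bigD1 w) //= !inE wu.
Qed.

Lemma card_common_nbr_ge G (X : {set G}) (e : R) :
  (forall w, w \in X -> (1 - e) * #|G|%:R <= #|nbr w|%:R) ->
  (1 - #|X|%:R * e) * #|G|%:R <= #|common_nbr X|%:R.
Proof.
move=> h; have := card_common_nbr X; rewrite -(ler_nat R) natrD natr_sum.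
have : \sum_(w in X) #|~: nbr w|%:R <= #|X|%:R * (e * #|G|%:R) :> R.
  rewrite mulr_natl -sumr_const; apply: ler_sum => w /h.
  have : #|nbr w|%:R + #|~: nbr w|%:R = #|G|%:R :> R by rewrite -natrD cardsC.
  lra.
lra.
Qed.

(** Large vertices turn out to be adjacent to almost everything, so [t + 1] of them would form a
    forbidden biclique with their common neighbours. Fewer than [t] would leave too few 2-walks from
    [top p] to account for [m ^ 2]. *)
Lemma large_structure (e : R) : 0 < e -> 2 * D%:R * e <= 1 -> 2 * (t%:R + 1) * e <= 1 ->
  exists N, forall G (p : profile R t D r G), (N <= #|G|)%N ->
  [/\ #|large p e| = t, forall w, w \in large p e -> 1 - e <= vec p w
    & (r <= #|common_nbr (large p e)|)%N].
Proof.
have D1 : 1 <= D%:R :> R by rewrite ler1n.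
have t1 : 1 <= t%:R :> R by rewrite ler1n.
move=> e0 eD et.
have e1 : 2 * e <= 1 by apply: le_trans eD; rewrite ler_pM2r //; lra.
have [c c0 [N1 hN1]] := large_deg_linear e0.
(* The three bounds serve, in order, the degree of a large vertex, its [c / 2 * n] common neighbours
   with [top p], and its entry. *)
pose d := Num.min (e / 2) (Num.min (c / 2) (c * e / 4)).
have d0 : 0 < d by rewrite !lt_min !divr_gt0 // ?mulr_gt0.
have [de dc dce] : [/\ d <= e / 2, d <= c / 2 & d <= c * e / 4].
  by rewrite /d !ge_min !lexx ?orbT.
have [N2 hN2] := deg_codeg d0.
have [N3 hN3] := eventually_ge (2 * r%:R).
have [N4 hN4] := eventually_ge (2 * t%:R ^+ 2 + 1).
exists (maxn (maxn N1 N2) (maxn N3 N4)) => G p.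
rewrite !geq_max => /andP [/andP [nN1 nN2] /andP [/hN3 nr /hN4 nt]].
set n := #|G|%:R in nr nt.
have t2 : 0 <= t%:R ^+ 2 :> R by rewrite sqr_ge0.
have n0 : 0 < n by lra.
have degn (v : G) : #|nbr v|%:R <= n by rewrite ler_nat max_card.
(* Taking [v = w = top p] makes the codegree term vanish. *)
have dtop : n - d * n <= #|nbr (top p)|%:R.
  have := hN2 G p (top p) (top p) nN2; rewrite vec_top subrr mul0r mulr1 addr0.
  have d1 : d <= 1 by lra.
  move=> /(_ d1); rewrite -/n => h.
  have : t%:R * (n - #|nbr (top p)|%:R) <= t%:R * (d * n).
    have : d * n <= t%:R * (d * n) by rewrite ler_peMl // mulr_ge0 // ltW.
    lra.
  rewrite ler_pM2l; lra.
(* First [v = top p]: its neighbourhood is almost everything and that of [w] is linear, so the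
   codegree is linear and forces [1 - vec p w] to be small. Then [v = w]: the entry near 1 forces
   almost full degree. *)
have big w : w \in large p e ->
    1 - e / 2 <= vec p w /\ (1 - e) * n <= #|nbr w|%:R.
  rewrite inE => ew; have dw : d <= vec p w by lra.
  have := hN1 G p w nN1 ew; rewrite -/n => degw.
  have xw : 1 - e / 2 <= vec p w.
    have := hN2 G p (top p) w nN2 dw; rewrite vec_top mulr1 -/n.
    set q := #|_ :&: _|%:R => h.
    have cq : (c / 2) * n <= q.
      have : #|nbr (top p)|%:R + #|nbr w|%:R <= n + q :> R.
        by rewrite -!natrD ler_nat -cardsUI leq_add2r max_card.
      have : d * n <= (c / 2) * n by rewrite ler_pM2r.
      lra.
    have h1 : (1 - vec p w) * q <= d * n.
      have : t%:R * #|nbr (top p)|%:R <= t%:R * n by rewrite ler_wpM2l.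
      lra.
    have h2 : (1 - vec p w) * (c / 2 * n) <= (c * e / 4) * n.
      apply: le_trans (_ : d * n <= _); last by rewrite ler_pM2r.
      by apply: le_trans h1; rewrite ler_wpM2l // subr_ge0 vec_le1.
    have : (1 - vec p w) * (c / 2 * n) <= e / 2 * (c / 2 * n) by lra.
    rewrite ler_pM2r ?mulr_gt0 ?divr_gt0 //; lra.
  split=> //; have := hN2 G p w w nN2 dw; rewrite -/n.
  set g := (1 - vec p w) * _.
  have g0 : 0 <= g by rewrite mulr_ge0 // subr_ge0 vec_le1.
  move=> h; have : t%:R * (n * vec p w) <= t%:R * (#|nbr w|%:R + e / 2 * n).
    have : d * n <= e / 2 * n by rewrite ler_pM2r.
    have : e / 2 * n <= t%:R * (e / 2 * n).
      by rewrite ler_peMl // mulr_ge0 ?divr_ge0 // ltW.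
    lra.
  rewrite ler_pM2l; last lra.
  have : n * (1 - e / 2) <= n * vec p w by rewrite ler_pM2l.
  lra.
have common (X : {set G}) : X \subset large p e -> (#|X| <= t.+1)%N ->
    (r <= #|common_nbr X|)%N.
  move=> /subsetP XL Xt; rewrite -(ler_nat R).
  have := @card_common_nbr_ge G X e (fun w wX => proj2 (big w (XL w wX))).
  rewrite -/n; apply: le_trans.
  have : #|X|%:R * e <= (t%:R + 1) * e.
    by rewrite ler_pM2r // natr1 ler_nat.
  move=> h; have : 1 / 2 * n <= (1 - #|X|%:R * e) * n by rewrite ler_pM2r //; lra.
  lra.
have le_t : (#|large p e| <= t)%N.
  rewrite leqNgt; apply/negP => /card_geqP [s [us ss sL]].
  pose X := [set w in s].
  have cX : #|X| = t.+1 by rewrite cardsE (card_uniqP us).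
  have XL : X \subset large p e by apply/subsetP => w; rewrite inE; apply: sL.
  have := common X XL; rewrite cX leqnn => /(_ isT); rewrite leqNgt.
  rewrite (no_biclique p (X := X)) ?cX // => a b aX.
  by rewrite inE => /forallP /(_ a); rewrite aX.
split.
- apply/eqP; rewrite eqn_leq le_t /= leqNgt; apply/negP => lt_t.
  have hS w : w \notin large p e -> vec p w <= e by rewrite inE -ltNge => /ltW.
  have := two_walks (top p) (ltW e0) hS; rewrite vec_top mulr1.
  have := rho_large p; rewrite -/n.
  set P := \sum_(u | _) _.
  (* With at most [t - 1] large vertices, each middle vertex contributes at most [t - 1]; adding the
     error [n / 2] stays below [t * (n - t)] for large [n]. *)
  have : P <= (t%:R - 1) * n.
    apply: le_trans (_ : \sum_(u | edge (top p) u) (t%:R - 1) <= _).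
      apply: ler_sum => u _; rewrite (_ : t%:R - 1 = t.-1%:R); last first.
        by rewrite -[in LHS](prednK t_gt0) -natr1 addrK.
      apply: le_trans (_ : \sum_(w in large p e) 1 <= _); last first.
        by rewrite sumr_const ler_nat -ltnS prednK.
      rewrite [X in _ <= X](bigID (edge u)) /= ler_wpDr ?sumr_ge0 //.
      by apply: ler_sum => w _; apply: vec_le1.
    by rewrite sum_const_nbr ler_wpM2l // subr_ge0.
  have : e * (D%:R * n) <= 1 / 2 * n by rewrite mulrA ler_pM2r //; lra.
  lra.
- by move=> w /big [h _]; lra.
- by apply: common => //; apply: leqW.
Qed.

End Asymptotics.

(** * Comparison with the target graph *)

Section Comparison.
Local Open Scope ring_scope.
Variable R : realType.

(** Degeneracy: sparsity provides a vertex [w] of [S] with at most [D] neighbours in [S]. Its terms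
    sum to at most [2 * D * e * x w], and induction handles the rest. *)
Lemma sparse_form_le (D : nat) (G : sgraph) (x : G -> R) (e : R) (S : {set G}) :
  0 <= e -> (forall U : {set G}, (arcs U <= D * #|U|)%N) ->
  (forall v, v \in S -> 0 <= x v <= e) ->
  \sum_(u in S) \sum_(v in S) (edge u v)%:R * (x u * x v)
    <= 2 * D%:R * e * \sum_(u in S) x u.
Proof.
move=> e0 sparse; have [n] := ubnP #|S|; elim: n => // n IH in S * => le_n hx.
have [->|S0] := eqVneq S set0; first by rewrite !big_set0 mulr0.
have [w wS dw] : exists2 w, w \in S & (#|nbr w :&: S| <= D)%N.
  apply/exists_inP; apply: contraT => /exists_inPn h.
  have : (D.+1 * #|S| <= arcs S)%N.
    rewrite mulnC -sum_nat_const; apply: leq_sum => w wS.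
    by rewrite ltnNge; apply: h.
  have : (0 < #|S|)%N by rewrite card_gt0.
  have := sparse S; lia.
have /andP [xw0 _] := hx w wS.
have hw : \sum_(v in S :\ w) (edge w v)%:R * (x w * x v) <= x w * (D%:R * e).
  apply: le_trans (_ : \sum_(v in nbr w :&: S) x w * e <= _); last first.
    rewrite sumr_const -[x w * e *+ _]mulr_natl [leLHS]mulrCA.
    by rewrite ler_wpM2l // ler_wpM2r // ler_nat.
  rewrite [X in _ <= X](eq_bigl (fun v => (v \in S) && edge w v)) => [|v].
    rewrite big_mkcondr [leRHS](big_setD1 w) //= edge_irrefl add0r; apply: ler_sum => v.
    move=> /setD1P [_ /hx /andP [_ xv]].
    by case: edge; rewrite ?mul1r ?mul0r // ler_wpM2l.
  by rewrite !inE andbC.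
have hxw v : v \in S :\ w -> 0 <= x v <= e by move=> /setD1P [_ /hx].
have lt_w : (#|S :\ w| < n)%N.
  by rewrite -ltnS; apply: leq_trans le_n; rewrite ltnS; apply/proper_card/properD1.
have IHw := IH (S :\ w) lt_w hxw.
rewrite (big_setD1 w) //= [X in _ <= _ * X](big_setD1 w) //= (big_setD1 w) //=.
rewrite edge_irrefl mul0r add0r.
under [X in _ + X]eq_bigr do rewrite (big_setD1 w) //= edge_sym [x _ * x w]mulrC.
rewrite big_split /=; nra.
Qed.

Lemma qformE (G : sgraph) (x : G -> R) :
  qform x = \sum_u \sum_v (edge u v)%:R * (x u * x v).
Proof.
apply: eq_bigr => u _; rewrite big_mkcond /=; apply: eq_bigr => v _.
by case: ifP; rewrite ?mul1r ?mul0r.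
Qed.

(** * The gain in the quadratic form on passing to the target graph *)

Section Gain.
Variables (t D r : nat) (G : sgraph) (p : profile R t D r G) (e : R).
Local Notation x := (vec p).
Variables (L : {set G}) (eT : rel G).
Hypotheses (e_ge0 : 0 <= e) (L_card : #|L| = t).
Hypotheses (L_large : forall l, l \in L -> 1 / 2 <= x l)
  (L_small : forall v, v \notin L -> x v <= e)
  (t_gt0 : (0 < t)%N).
Hypotheses (eT_sym : symmetric eT) (eT_irrefl : irreflexive eT)
  (eT_L : forall l v, l \in L -> v != l -> eT l v)
  (eT_A : forall u v, u \in common_nbr L -> v \in common_nbr L ->
     edge u v -> eT u v).
Let A := common_nbr L.
Let B := ~: (L :|: A).
Let T := SGraph eT_sym eT_irrefl.

Let x0 v : 0 <= x v. Proof. exact: vec_ge0. Qed.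

Let LA l a : l \in L -> a \in A -> edge l a.
Proof. by move=> lL; rewrite inE => /forallP /(_ l); rewrite lL. Qed.

Let Lirr l : l \in L -> l \in A -> False.
Proof. by move=> lL /(LA lL); rewrite edge_irrefl. Qed.

Let nbrA v : v \notin L -> (#|nbr v :&: A| <= r)%N.
Proof.
move=> vL; apply: ltnW; apply: (no_biclique p (X := v |: L)).
  move=> a b; rewrite inE => /orP [/set1P ->|aL]; rewrite inE => /andP [].
    by rewrite inE.
  by move=> _; apply: LA.
by rewrite cardsU1 vL L_card.
Qed.

(* In units of [x u], for each [u] in [B]: a missing edge to [L] weighs at      *)
(* least 1/2, the edges to [A] at most [r * e], and those inside [B], each      *)
(* charged to one end by degeneracy, at most [D * e].                           *)
Lemma target_form_gain :
  qform (x : G -> R) + (1 - 2 * r%:R * e - 2 * D%:R * e) * \sum_(u in B) x u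
    <= qform (x : T -> R).
Proof.
(* A pair between [B] and its complement is charged to its end in [B]. Summed over ordered pairs,
   [h] counts twice and [k] once, whence the coefficients in the statement. *)
pose h (u v : G) : R := if u \in B then
    if v \in L then (1 - (edge u v)%:R) * (x u / 2)
    else if v \in A then - ((edge u v)%:R * (x u * e)) else 0
  else 0.
pose k (u v : G) : R :=
  if u \in B then if v \in B then (edge u v)%:R * (x u * x v) else 0 else 0.
have term (u v : G) :
    h u v + h v u - k u v + (edge u v)%:R * (x u * x v) <= (eT u v)%:R * (x u * x v).
  have xx : 0 <= x u * x v by rewrite mulr_ge0.
  rewrite /h /k; have inB w : (w \in B) = (w \notin L) && (w \notin A).
    by rewrite !inE negb_or.
  have eTL w z : w \in L -> (edge w z)%:R <= (eT w z)%:R :> R.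
    move=> wL; have [->|zw] := eqVneq z w; first by rewrite edge_irrefl.
    by rewrite eT_L // ler_nat leq_b1.
  rewrite !inB; have [uL|uL] /= := boolP (u \in L).
    have [vL|vL] /= := boolP (v \in L).
      by rewrite subr0 !add0r ler_wpM2r // eTL.
    have [vA|vA] /= := boolP (v \in A).
      by rewrite subr0 !add0r ler_wpM2r // eTL.
    have -> : eT u v by apply: eT_L => //; apply: contraNneq vL => ->.
    rewrite [edge v u]edge_sym; case: edge => /=; first by lra.
    have := L_large uL; have := x0 v; nra.
  have [vL|vL] /= := boolP (v \in L).
    have -> : eT u v.
      by rewrite eT_sym; apply: eT_L => //; apply: contraNneq uL => ->.
    have [uA|uA] /= := boolP (u \in A).
      by rewrite subr0 !add0r ler_wpM2r // ler_nat leq_b1.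
    case: edge => /=; first by lra.
    have := L_large vL; have := x0 u; nra.
  have [uA|uA] /= := boolP (u \in A); have [vA|vA] /= := boolP (v \in A).
  - rewrite subr0 !add0r ler_wpM2r // ler_nat.
    by have := eT_A uA vA; case: edge => // ->.
  - rewrite [edge v u]edge_sym; case: edge; last by case: eT; rewrite /=; lra.
    have := L_small uL; have := x0 v; case: eT => /=; nra.
  - case: edge; last by case: eT; rewrite /=; lra.
    have := L_small vL; have := x0 u; case: eT => /=; nra.
  - by case: eT => /=; lra.
rewrite !qformE; apply: le_trans (_ : \sum_u \sum_v
    (h u v + h v u - k u v + (edge u v)%:R * (x u * x v)) <= _); last first.
  by apply: ler_sum => u _; apply: ler_sum => v _; apply: term.
have -> : \sum_u \sum_v (h u v + h v u - k u v + (edge u v)%:R * (x u * x v)) =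
    \sum_u \sum_v h u v + \sum_u \sum_v h u v - \sum_u \sum_v k u v
    + \sum_u \sum_v (edge u v)%:R * (x u * x v).
  rewrite [X in _ + X - _]exchange_big -sumrN -!big_split /=.
  by apply: eq_bigr => u _; rewrite -sumrN -!big_split.
have hle : (1 / 2 - r%:R * e) * \sum_(u in B) x u <= \sum_u \sum_v h u v.
  rewrite mulr_sumr big_mkcond; apply: ler_sum => u _; rewrite /h.
  case: ifP => [uB|_]; last by rewrite sumr_ge0.
  have [uL uA] : u \notin L /\ u \notin A.
    by move: uB; rewrite inE in_setU negb_or => /andP [].
  apply: le_trans (_ : x u / 2 - r%:R * (x u * e) <= _); first by lra.
  have -> : \sum_v (if v \in L then (1 - (edge u v)%:R) * (x u / 2)
      else if v \in A then - ((edge u v)%:R * (x u * e)) else 0) =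
      \sum_(v in L) (1 - (edge u v)%:R) * (x u / 2)
      - \sum_(v in A) (edge u v)%:R * (x u * e).
    rewrite [X in _ = X - _]big_mkcond [X in _ = _ - X]big_mkcond -sumrB.
    apply: eq_bigr => v _; case: ifPn => [vL|_]; case: ifPn => vA //; try lra.
    by case: (Lirr vL vA).
  apply: lerB.
    move: uA; rewrite inE negb_forall => /existsP [l].
    rewrite negb_imply edge_sym => /andP [lL /negPf ul].
    rewrite (bigD1 l) //= ul subr0 mul1r ler_wpDr // sumr_ge0 // => v _.
    by rewrite mulr_ge0 ?divr_ge0 // subr_ge0 lern1 leq_b1.
  apply: le_trans (_ : #|nbr u :&: A|%:R * (x u * e) <= _); last first.
    by rewrite ler_wpM2r ?mulr_ge0 // ler_nat nbrA.
  rewrite mulr_natl -sumr_const [X in _ <= X](eq_bigl (fun v => (v \in A) && edge u v)).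
    rewrite big_mkcondr; apply: ler_sum => v _.
    by case: edge; rewrite ?mul1r ?mul0r.
  by move=> v; rewrite !inE andbC.
have kle : \sum_u \sum_v k u v <= 2 * D%:R * e * \sum_(u in B) x u.
  have -> : \sum_u \sum_v k u v =
      \sum_(u in B) \sum_(v in B) (edge u v)%:R * (x u * x v).
    rewrite [RHS]big_mkcond; apply: eq_bigr => u _; rewrite /k.
    case: ifP => _; last by rewrite big1.
    by rewrite [RHS]big_mkcond.
  apply: sparse_form_le => //; first exact: (arcs_le p).
  move=> v; rewrite inE in_setU negb_or => /andP [vL _].
  by rewrite x0 L_small.
lra.
Qed.

(** Testing the Perron vector of [G] on [T] closes a chain of inequalities. Hence the radii agree,
    the vector is also an eigenvector of [T], and the gain is zero; positivity of its entries then
    empties [B] and excludes extra edges in [T]. *)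
Lemma target_extremal : 2 * r%:R * e + 2 * D%:R * e < 1 ->
  rho p = spectral_radius R G -> spectral_radius R T <= spectral_radius R G ->
  spectral_radius R T = spectral_radius R G /\ forall u v : G, eT u v = edge u v.
Proof.
move=> small rhoE le_TG.
have G0 : (0 < #|G|)%N by apply/card_gt0P; exists (top p).
have [leT eqT _] := @spectral_radius_spec R T G0.
have qG : qform (x : G -> R) = spectral_radius R G * sqsum (x : G -> R).
  rewrite /qform /sqsum mulr_sumr; apply: eq_bigr => u _.
  by rewrite -mulr_sumr -vec_eigen rhoE expr2 mulrCA.
have s0 : 0 < sqsum (x : G -> R).
  by apply: (@sqsum_gt0 _ _ _ (top p)); rewrite vec_top oner_eq0.
have := target_form_gain; set c := (1 - _ - _); set b := \sum_(u in B) x u => gain.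
have c0 : 0 < c by rewrite /c; lra.
have b0 : 0 <= b by rewrite sumr_ge0.
have cb0 : 0 <= c * b by rewrite mulr_ge0 // ltW.
have leTx := leT x.
have sT : sqsum (x : T -> R) = sqsum (x : G -> R) by [].
have radE : spectral_radius R T = spectral_radius R G.
  apply/eqP; rewrite eq_le le_TG /= -(ler_pM2r s0) -qG -sT; lra.
split=> //; rewrite sT radE -qG in leTx.
have qTG : qform (x : T -> R) = qform (x : G -> R) by apply/eqP; rewrite eq_le leTx /=; lra.
have eigT := eqT x; rewrite sT radE -qG qTG in eigT.
have {}eigT := eigT erefl.
(* A vertex outside [L] is adjacent in [T] to all of [L], where entries are at least 1/2, so the
   eigenvalue equation of [T] excludes a zero entry. *)
have xpos v : 0 < x v.
  have [vL|vL] := boolP (v \in L); first by have := L_large vL; lra.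
  rewrite lt_neqAle x0 andbT eq_sym; apply/eqP => xv.
  have [l lL] : exists l, l \in L by apply/card_gt0P; rewrite L_card.
  have := eigT v; rewrite xv mulr0 (bigD1 l) /=; last first.
    by rewrite /edge /= eT_sym eT_L //; apply: contraNneq vL => ->.
  have : 0 <= \sum_(i | edge (v : T) i && (i != l)) x i by rewrite sumr_ge0.
  have := L_large lL; lra.
have bE : b = 0 by nra.
have B0 v : v \notin B.
  apply/negP => vB; have := xpos v; rewrite lt_neqAle => /andP [/eqP ne _].
  apply: ne; apply/esym; apply: (psumr_eq0P (P := mem B) (F := x)) => //.
have sub (u v : G) : edge u v -> eT u v.
  have inLA w : (w \in L) || (w \in A).
    by have := B0 w; rewrite !inE negbK.
  move=> uv; have nuv : u != v by apply: contraTneq uv => ->; rewrite edge_irrefl.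
  have /orP [uL|uA] := inLA u; first by rewrite eT_L // eq_sym.
  have /orP [vL|vA] := inLA v; first by rewrite eT_sym eT_L.
  exact: eT_A.
pose d (u v : G) := ((eT u v)%:R - (edge u v)%:R) * (x u * x v).
have d0 u v : 0 <= d u v.
  rewrite mulr_ge0 ?mulr_ge0 // subr_ge0 ler_nat.
  by have := sub u v; case: edge => // ->.
have dsum : \sum_u \sum_v d u v = 0.
  transitivity (qform (x : T -> R) - qform (x : G -> R)); last by rewrite qTG subrr.
  rewrite !qformE -sumrB; apply: eq_bigr => u _; rewrite -sumrB.
  by apply: eq_bigr => v _; rewrite /d mulrBl.
move=> u v; have du : \sum_w d u w = 0.
  by apply: (psumr_eq0P _ dsum) => // w _; rewrite sumr_ge0.
have : d u v = 0 by apply: (psumr_eq0P _ du) => // w _; apply: d0.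
have := sub u v; rewrite /d; case: (edge u v) => [->//|_].
case: (eT u v) => //; rewrite subr0 mul1r => /eqP.
by rewrite mulf_eq0 !gt_eqF.
Qed.

End Gain.
End Comparison.

(** * Targets of the form K_t joined with a graph *)

Section JoinTargets.
Local Open Scope ring_scope.
Variable R : realType.
Implicit Types (G H K : sgraph).

Lemma max_entry G (x : G -> R) : (0 < #|G|)%N -> exists v, forall u, (x u <= x v)%R.
Proof.
case/card_gt0P => v0 _.
have [v _ h] := @Order.TotalTheory.arg_maxP _ _ _ v0 xpredT x isT.
by exists v => u; apply: h.
Qed.

Lemma spectral_radius_ge0 G : (0 < #|G|)%N -> (0 <= spectral_radius R G)%R.
Proof.
move=> G0; have [_ _ [x [x0 [v xv] eig]]] := spectral_radius_spec R G0.
have xv0 : (0 < x v)%R by rewrite lt_neqAle x0 eq_sym xv.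
by rewrite -(pmulr_lge0 _ xv0) eig sumr_ge0.
Qed.

Lemma spectral_radius_biclique G (X : {set G}) : (0 < #|G|)%N ->
  (forall u v, u \in X -> v \notin X -> edge u v) ->
  (#|X|%:R * (#|G|%:R - #|X|%:R) <= spectral_radius R G ^+ 2)%R.
Proof.
move=> G0 hX; have lam0 := spectral_radius_ge0 G0.
have [hle _ _] := spectral_radius_spec R G0.
set lam := spectral_radius R G in lam0 hle *.
have cC : #|~: X|%:R = #|G|%:R - #|X|%:R :> R.
  by rewrite -(cardsC X) natrD addrAC subrr add0r.
rewrite -cC; set a := #|X|%:R; set b := #|~: X|%:R.
have a0 : 0 <= a by rewrite ler0n.
have b0 : 0 <= b by rewrite ler0n.
have [->|ab] := eqVneq (a * b) 0; first by rewrite exprn_ge0.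
have ab0 : 0 < a * b by rewrite lt_neqAle eq_sym ab mulr_ge0.
pose sa := Num.sqrt a; pose sb := Num.sqrt b.
have sa2 : sa ^+ 2 = a by rewrite sqr_sqrtr.
have sb2 : sb ^+ 2 = b by rewrite sqr_sqrtr.
have sa0 : 0 <= sa := sqrtr_ge0 _.
have sb0 : 0 <= sb := sqrtr_ge0 _.
(* The Perron vector of the complete bipartite graph between [X] and its complement, with Rayleigh
   quotient [sa * sb] there; further edges only increase the form. *)
pose y u := if u \in X then sb else sa.
have sqy : sqsum y = 2 * (a * b).
  rewrite /sqsum (bigID (mem X)) /= (eq_bigr (fun=> b)) => [|u uX]; last first.
    by rewrite /y uX sb2.
  rewrite [X in _ + X](eq_bigr (fun=> a)) => [|u uX]; last first.
    by rewrite /y (negPf uX) sa2.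
  rewrite !sumr_const -[b *+ _]mulr_natr -[a *+ _]mulr_natr.
  have -> : #|[pred i | i \notin X]|%:R = b :> R.
    by congr _%:R; apply: eq_card => u; rewrite !inE.
  rewrite -/a; ring.
have qy : 2 * (a * b) * (sa * sb) <= qform y.
  pose E (u v : G) : R := if (u \in X) && (v \notin X) then sa * sb else 0.
  have -> : 2 * (a * b) * (sa * sb) = \sum_u \sum_v (E u v + E v u).
    have half : \sum_u \sum_v E u v = a * b * (sa * sb).
      transitivity (\sum_(u in X) \sum_(v in ~: X) sa * sb).
        rewrite [RHS]big_mkcond; apply: eq_bigr => u _; rewrite /E.
        case: (u \in X) => /=; last by rewrite big1.
        by rewrite [RHS]big_mkcond; apply: eq_bigr => v _; rewrite inE.
      rewrite sumr_const sumr_const -[_ *+ #|~: X|]mulr_natl -[_ *+ #|X|]mulr_natl.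
      by rewrite mulrA.
    under eq_bigr do rewrite big_split.
    by rewrite big_split /= [X in _ + X]exchange_big half; ring.
  rewrite qformE; apply: ler_sum => u _; apply: ler_sum => v _.
  have yy : 0 <= (edge u v)%:R * (y u * y v).
    by rewrite !mulr_ge0 // /y; case: ifP.
  rewrite /E; have [uX|uX] := boolP (u \in X); have [vX|vX] := boolP (v \in X);
    rewrite ?addr0 ?add0r //=.
  - by rewrite hX // /y uX (negPf vX) mul1r mulrC.
  - by rewrite edge_sym hX // /y vX (negPf uX) mul1r.
have h : sa * sb <= lam.
  have ab2 : 0 < 2 * (a * b) by rewrite mulr_gt0.
  rewrite -(ler_pM2l ab2); apply: le_trans qy _.
  by apply: le_trans (hle y) _; rewrite sqy mulrC.
have : (sa * sb) ^+ 2 <= lam ^+ 2 by rewrite ler_pXn2r // nnegrE // mulr_ge0.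
by rewrite exprMn sa2 sb2.
Qed.

Lemma card_join G H : #|join G H| = (#|G| + #|H|)%N.
Proof. exact: card_sum. Qed.

Lemma spectral_radius_join (t : nat) K : (0 < t)%N ->
  (t%:R * (#|join (complete t) K|%:R - t%:R)
     <= spectral_radius R (join (complete t) K) ^+ 2)%R.
Proof.
move=> t0; pose X : {set join (complete t) K} := [set inl i | i in [set: 'I_t]].
have cX : #|X| = t by rewrite card_imset ?cardsT ?card_ord //; apply: inl_inj.
have XE u v : u \in X -> v \notin X -> edge u v.
  by move=> /imsetP [i _ ->]; case: v => // j; rewrite imset_f ?inE.
have J0 : (0 < #|join (complete t) K|)%N by rewrite card_join /= card_ord addn_gt0 t0.
by have := spectral_radius_biclique J0 XE; rewrite cX.
Qed.

Lemma join_bijection (t : nat) K G (L : {set G}) (g : G -> K) :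
  (0 < t)%N -> #|L| = t -> #|K| = (#|G| - t)%N -> {in ~: L &, injective g} ->
  exists f : G -> join (complete t) K, [/\ bijective f,
    forall l v, l \in L -> v != l -> edge (f l) (f v)
  & forall u v, u \notin L -> v \notin L -> edge (f u) (f v) = edge (g u) (g v)].
Proof.
move=> t0 cL cK ginj; have Lle : (#|L| <= #|[set: 'I_t]|)%N by rewrite cardsT card_ord cL.
have [h [_ hinj]] := set_injection (fun=> Ordinal t0) Lle.
pose f u : join (complete t) K := if u \in L then inl (h u) else inr (g u).
have finj : injective f.
  move=> u v; rewrite /f; case: ifPn => uL; case: ifPn => vL // [].
    exact: hinj.
  by apply: ginj; rewrite inE.
exists f; split.
- apply: inj_card_bij => //; rewrite card_join /= card_ord cK subnKC //.
  by rewrite -cL max_card.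
- move=> l v lL vl; rewrite /f lL; case: ifPn => vL //.
  by rewrite /edge /= /edge /=; apply: contraNneq vl => /hinj ->.
- by move=> u v uL vL; rewrite /f (negPf uL) (negPf vL).
Qed.

Lemma pullback_sym G H (f : G -> H) : symmetric (fun u v => edge (f u) (f v)).
Proof. by move=> u v; rewrite edge_sym. Qed.

Lemma pullback_irrefl G H (f : G -> H) : irreflexive (fun u v => edge (f u) (f v)).
Proof. by move=> u; rewrite edge_irrefl. Qed.

(** The spectral argument common to both cases. The last hypothesis carries the structure particular
    to each: how the vertices outside the hubs fit into [K]. *)
Lemma join_extremal (t D r : nat) (P : sgraph -> Prop) (K : nat -> sgraph) :
  (0 < t)%N -> (0 < D)%N -> (forall k, #|K k| = k) ->
  (forall G, P G -> forall S : {set G}, (arcs S <= D * #|S|)%N) ->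
  (forall G, P G -> forall X Y : {set G},
    (forall a b, a \in X -> b \in Y -> edge a b) -> (t < #|X|)%N -> (#|Y| < r)%N) ->
  (forall G (L : {set G}), P G -> #|L| = t -> (t < #|G|)%N ->
    (r <= #|common_nbr L|)%N -> exists g : G -> K (#|G| - t)%N, {in ~: L &, injective g} /\
      {in common_nbr L &, {homo g : u v / edge u v}}) ->
  exists N, forall n G, #|G| = n -> (N <= n)%N -> P G ->
    let J := join (complete t) (K (n - t)%N) in
    (spectral_radius R G <= spectral_radius R J)%R /\
    (spectral_radius R G = spectral_radius R J <-> isomorphic G J).
Proof.
move=> t0 D0 cK sparse nobicl embed.
have D1 : 1 <= D%:R :> R by rewrite ler1n.
(* Small enough for [large_structure] and for a positive gain in [target_extremal]. *)
pose e : R := (4 * (D%:R + r%:R + t%:R + 1))^-1.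
have r0 : 0 <= r%:R :> R by rewrite ler0n.
have tr0 : 0 <= t%:R :> R by rewrite ler0n.
have den0 : 0 < 4 * (D%:R + r%:R + t%:R + 1) :> R by lra.
have e0 : 0 < e by rewrite invr_gt0.
have eE : e * (4 * (D%:R + r%:R + t%:R + 1)) = 1.
  by rewrite mulVf // gt_eqF.
have er : 0 <= e * r%:R by rewrite mulr_ge0 // ltW.
have et : 0 <= e * t%:R by rewrite mulr_ge0 // ltW.
have eD : e <= e * D%:R by rewrite ler_peMr // ltW.
have [||N hN] := large_structure r t0 D0 e0; [lra|lra|].
exists (maxn N t.+1) => n G Gn; rewrite geq_max -Gn => /andP [nN tn] PG J.
have G0 : (0 < #|G|)%N by apply: leq_trans tn.
have cJ : #|J| = #|G| by rewrite card_join /= card_ord cK subnKC // ltnW.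
have [lt_GJ|le_JG] := ltP (spectral_radius R G) (spectral_radius R J).
  split; first exact: ltW.
  split=> [E|/(spectral_radius_iso R G0) E]; by rewrite E ltxx in lt_GJ.
have [_ _ [y [y0 [w yw] eigy]]] := spectral_radius_spec R G0.
have [v0 ymax] := max_entry y G0.
have yv0 : 0 < y v0.
  by apply: lt_le_trans (ymax w); rewrite lt_neqAle y0 eq_sym yw.
have J0 : (0 < #|J|)%N by rewrite cJ.
have radJ : t%:R * (#|G|%:R - t%:R) <= spectral_radius R G ^+ 2.
  rewrite -{1}cJ; apply: le_trans (spectral_radius_join _ t0) _.
  by rewrite ler_pXn2r // nnegrE spectral_radius_ge0.
have [p rhoE] : exists p : profile R t D r G, rho p = spectral_radius R G.
  unshelve eexists (@Profile _ _ _ _ _ (spectral_radius R G)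
    (fun v => y v / y v0) v0 _ _ _ _ _ radJ (sparse G PG) (nobicl G PG)) => //.
  - exact: spectral_radius_ge0.
  - by move=> v; rewrite divr_ge0.
  - by move=> v; rewrite ler_pdivrMr // mul1r.
  - by rewrite /= divff // gt_eqF.
  - by move=> v; rewrite mulrA eigy mulr_suml.
have [cL Lbig Acard] := hN G p nN.
set L := large p e in cL Lbig Acard.
have [g [ginj ghom]] := embed G L PG cL tn Acard.
have [f [fbij fL fA]] := join_bijection t0 cL (cK _) ginj.
have AL a : a \in common_nbr L -> a \notin L.
  rewrite inE => /forallP /(_ a); case: (a \in L) => //=.
  by rewrite edge_irrefl.
(* The target carried back to the vertices of [G], so that both forms are evaluated at the same
   vector. *)
pose T := SGraph (pullback_sym f) (pullback_irrefl f).
have radT : spectral_radius R T = spectral_radius R J.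
  apply: spectral_radius_iso => //; exists f => //.
have L_half l : l \in L -> 1 / 2 <= vec p l by move=> /Lbig; lra.
have L_small v : v \notin L -> vec p v <= e by rewrite inE -ltNge => /ltW.
have f_A u v : u \in common_nbr L -> v \in common_nbr L -> edge u v ->
    edge (f u) (f v).
  by move=> uA vA uv; rewrite fA ?AL // ghom.
have small : 2 * r%:R * e + 2 * D%:R * e < 1 by lra.
have le_TG : spectral_radius R T <= spectral_radius R G by rewrite radT.
have [radE fE] := target_extremal (ltW e0) cL L_half L_small t0 fL f_A small rhoE le_TG.
rewrite -radT radE; split=> //; split=> // _.
by exists f => // u v; rewrite -fE.
Qed.

End JoinTargets.

(** * Embedding the vertices outside the hubs *)

Section OutsideParts.
Implicit Types G : sgraph.

Lemma edgeless_embedding t G (L A : {set G}) :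
  #|L| = t -> t < #|G| -> {in A &, forall u v, ~~ edge u v} ->
  exists g : G -> edgeless (#|G| - t), {in ~: L &, injective g} /\
    {in A &, {homo g : u v / edge u v}}.
Proof.
rewrite -subn_gt0 => cL tG noA.
have le_LG : #|~: L| <= #|[set: 'I_(#|G| - t)]|.
  by rewrite cardsT card_ord cardsCs setCK cL.
have [g [_ ginj]] := set_injection (fun=> Ordinal tG) le_LG.
exists g; split=> // u v uA vA uv.
by have := noA u v uA vA; rewrite uv.
Qed.

(* The listing puts the two ends of every edge of a matching at positions      *)
(* [2k] and [2k+1].                                                            *)
Lemma matching_listing (T : finType) (e : rel T) (S : {set T}) :
  symmetric e -> irreflexive e -> (forall u v w, e u w -> e v w -> u = v) ->
  exists s : seq T, [/\ uniq s, s =i S &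
    {in S &, forall u v, e u v -> (index u s)./2 = (index v s)./2}].
Proof.
move=> esym eirr match_e; have [n] := ubnP #|S|; elim: n => // n IH in S *.
move=> le_n; have [/exists_inP [u uS /exists_inP [v vS uv]]|none] :=
    boolP [exists u in S, [exists v in S, e u v]]; last first.
  exists (enum S); split=> [||u v uS vS uv]; first exact: enum_uniq.
    by move=> u; rewrite mem_enum.
  case/negP: none; apply/exists_inP; exists u => //.
  by apply/exists_inP; exists v.
have nuv : u != v by apply: contraTneq uv => ->; rewrite eirr.
have [|s [us sS es]] := IH (S :\ u :\ v).
  apply: leq_trans (_ : #|S| <= n); last by rewrite -ltnS.
  by rewrite (cardsD1 u S) uS ltnS subset_leq_card // subsetDl.
have inS w : (w \in s) = [&& w != v, w != u & w \in S] by rewrite sS !inE.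
exists [:: u, v & s]; split.
- by rewrite /= !inE !inS eqxx /= eqxx andbF orbF nuv us.
- move=> w; rewrite !inE inS.
  have [->|_] := eqVneq w u; first by rewrite uS.
  by have [->|_] := eqVneq w v; first by rewrite vS.
move=> a b aS bS ab /=.
have part c d : e c d -> c \in [:: u; v] -> d \in [:: u; v].
  move=> cd; rewrite !inE => /orP [] /eqP E; rewrite {}E in cd.
    by rewrite (match_e d v u) ?eqxx ?orbT // esym.
  by rewrite (match_e d u v) ?eqxx // esym.
have idx c : c \in [:: u; v] -> (index c [:: u, v & s])./2 = 0.
  by rewrite !inE => /orP [] /eqP -> /=; rewrite ?eqxx //; case: eqVneq.
have [a2|a2] := boolP (a \in [:: u; v]).
  by have := idx a a2; have := idx b (part a b ab a2); rewrite /= => -> ->.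
have b2 : b \notin [:: u; v].
  by apply: contraNN a2 => b2; apply: part b2; rewrite esym.
move: a2 b2; rewrite !inE !negb_or => /andP [au av] /andP [bu bv].
rewrite ![u == _]eq_sym ![v == _]eq_sym.
rewrite (negPf au) (negPf av) (negPf bu) (negPf bv) /=.
by congr _.+1; apply: es => //; rewrite !inE ?au ?av ?bu ?bv.
Qed.

Definition matching_part k : sgraph := gunion (matching k./2) (complete (odd k)).

Lemma card_matching_part k : #|matching_part k| = k.
Proof.
rewrite card_sum /= card_prod !card_ord card_bool addnC muln2.
exact: odd_double_half.
Qed.

(** List the vertices outside [L] by [matching_listing]. Position [i] goes to the end [odd i] of the
    edge [i./2], and a last unpaired position goes to the isolated vertex. *)
Lemma matching_embedding t G (L A : {set G}) :
  #|L| = t -> t < #|G| -> [disjoint L & A] ->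
  {in A & &, forall u v w, edge u w -> edge v w -> u = v} ->
  exists g : G -> matching_part (#|G| - t), {in ~: L &, injective g} /\
    {in A &, {homo g : u v / edge u v}}.
Proof.
move=> cL tG dLA matchA; set m := #|G| - t.
have m0 : 0 < m by rewrite subn_gt0.
pose e u v := [&& u \in A, v \in A & edge u v].
have [|||s [us sL es]] := @matching_listing _ e (~: L).
- by move=> u v; rewrite /e edge_sym andbCA.
- by move=> u; rewrite /e edge_irrefl !andbF.
- by move=> u v w /and3P [uA wA uw] /and3P [vA _ vw]; apply: matchA uw vw.
have size_s : size s = m.
  by rewrite -(card_uniqP us) (eq_card sL) cardsCs setCK cL.
have [k0 _] : exists k0, k0 \in matching_part m.
  by apply/card_gt0P; rewrite card_matching_part.
(* The isolated vertex for odd [m]. For even [m] the arbitrary [k0] stands in; every vertex outside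
   [L] then has a position among the pairs. *)
pose last_pt : matching_part m :=
  if insub 0 is Some z then inr (z : 'I_(odd m)) else k0.
pose g u : matching_part m :=
  if insub (index u s)./2 is Some k then inl (k : 'I_m./2, odd (index u s))
  else last_pt.
have idx u : u \notin L -> index u s < m.
  by move=> uL; rewrite -size_s index_mem sL inE.
have mE := odd_double_half m.
have lastE u : u \notin L -> m./2 <= (index u s)./2 ->
    index u s = m./2.*2 /\ exists z, last_pt = inr z.
  move=> /idx lt le; have iE := odd_double_half (index u s).
  have m1 : odd m by move: lt le mE iE; case: (odd m); case: odd => /=; lia.
  split; first by move: lt le mE iE; rewrite m1; case: odd => /=; lia.
  rewrite /last_pt; case: insubP => [z _ _|]; first by exists z.
  by case/negP; rewrite m1.
exists g; split=> [u v|u v uA vA uv].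
  rewrite !inE => uL vL; rewrite /g.
  have inj_idx : index u s = index v s -> u = v.
    move=> E; rewrite -(nth_index u (s := s) (x := u)) ?sL ?inE // E.
    by rewrite nth_index ?sL ?inE.
  case: insubP => [a _ aE|na]; case: insubP => [b _ bE|nb].
  - case=> ab oab; apply: inj_idx.
    by rewrite -(odd_double_half (index u s)) -(odd_double_half (index v s))
      oab -aE -bE ab.
  - by rewrite -leqNgt in nb; have [_ [z ->]] := lastE v vL nb.
  - by rewrite -leqNgt in na; have [_ [z ->]] := lastE u uL na.
  - rewrite -!leqNgt in na nb; move=> _; apply: inj_idx.
    by have [-> _] := lastE u uL na; have [-> _] := lastE v vL nb.
have AL w : w \in A -> w \notin L by move=> wA; rewrite (disjointFl dLA wA).
have uvE : (index u s)./2 = (index v s)./2.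
  by apply: es; rewrite ?inE ?AL // /e uA vA uv.
have nidx : index u s != index v s.
  apply: contraTneq uv => E; suff -> : u = v by rewrite edge_irrefl.
  rewrite -(nth_index u (s := s) (x := u)) ?sL ?inE ?AL // E.
  by rewrite nth_index ?sL ?inE ?AL.
rewrite /g uvE; have [lu lv] := (idx u (AL u uA), idx v (AL v vA)).
have uI := odd_double_half (index u s); have vI := odd_double_half (index v s).
case: insubP => [a _ _|].
  rewrite /edge /= /edge /= /matching_rel /= eqxx /=.
  apply: contraNneq nidx => oE; by rewrite -uI -vI uvE oE.
rewrite -leqNgt => le; case/negP: nidx; apply/eqP.
have [-> _] := lastE v (AL v vA) le; rewrite -uvE in le.
by have [-> _] := lastE u (AL u uA) le.
Qed.

End OutsideParts.

(** * Complete graphs with the edges of disjoint paths removed *)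

Section CompleteMinusPaths.
Variables (r : nat) (ps : seq (seq 'I_r)).
Local Notation F := (complete_minus_paths ps).

(** The prefix [s1] gives access to the second edge of a path, needed in case (ii). *)
Lemma path_head_nonadjacent (s1 s2 : seq 'I_r) (a b : 'I_r) :
  s1 ++ [:: a, b & s2] \in ps -> ~~ edge (a : F) b.
Proof.
move=> pP; rewrite /edge /= /complete_minus_paths_rel negb_and !negbK; apply/orP; right.
apply/hasP; exists (s1 ++ [:: a, b & s2]) => //; apply/orP; left.
elim: s1 {pP} => [|c [|d s] IH]; rewrite /= !inE ?eqxx ?orbT //.
by rewrite [X in _ || X]IH orbT.
Qed.

Lemma has_model_complete (G : sgraph) :
  has_model (complete r) G -> has_model F G.
Proof.
case=> B [B0 Bc Bd Be]; exists B; split=> // i j.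
by case/andP => ij _; apply: Be.
Qed.

(** A model of [K_r] is also one of its subgraph [F]; density [2 ^ r.-1] yields a model of [K_r],
    whence the exponent. *)
Lemma minor_free_sparse (G : sgraph) (S : {set G}) :
  0 < r -> minor_free F G -> arcs S <= 2 ^ r.-1 * #|S|.
Proof.
move=> r0 /minor_free_no_model noF; rewrite leqNgt; apply/negP => lt.
apply: noF; apply: has_model_complete.
have S0 : S != set0 by apply: contraTneq lt => ->; rewrite /arcs big_set0 ltn0.
have := dense_complete_model S0 (ltnW lt); rewrite prednK // => -[B hB _].
by exists B.
Qed.

End CompleteMinusPaths.

Theorem theorem1p5 (R : realType) (r : nat) (hr : 4 <= r)
    (ps : seq (seq 'I_r)) (hl : 1 <= size ps) (hps : disjoint_paths ps) :
  exists N : nat, forall (n : nat) (G : sgraph),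
    #|G| = n -> N <= n -> minor_free (complete_minus_paths ps) G ->
    ((forall p, p \in ps -> size p = 2) ->
       (spectral_radius R G <= spectral_radius R (graphF n (r - 3)))%R /\
       (spectral_radius R G = spectral_radius R (graphF n (r - 3)) <->
          isomorphic G (graphF n (r - 3)))) /\
    ((exists2 p, p \in ps & 3 <= size p) ->
       (spectral_radius R G <= spectral_radius R (graphS n (r - 3)))%R /\
       (spectral_radius R G = spectral_radius R (graphS n (r - 3)) <->
          isomorphic G (graphS n (r - 3)))).
Proof.
set F := complete_minus_paths ps; have [hpath _] := hps.
pose P G := minor_free F G.
have cF : #|F| = r by rewrite card_ord.
have [a [b [nab eab]]] : exists a b : F, a != b /\ ~~ edge a b.
  have [p pP] : exists p, p \in ps.
    by case: (ps) hl => // p s _; exists p; rewrite mem_head.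
  case: p pP (hpath p pP) => [|a [|b s]] //= pP /andP [ab _].
  exists a, b; split; first by apply: contraNneq ab => ->; rewrite mem_head.
  exact: (path_head_nonadjacent (s1 := [::]) pP).
have t0 : 0 < r - 3 by rewrite subn_gt0.
have D0 : 0 < 2 ^ r.-1 by rewrite expn_gt0.
have sparse G : P G -> forall S : {set G}, arcs S <= 2 ^ r.-1 * #|S|.
  by move=> PG S; apply: (@minor_free_sparse r ps) => //; apply: leq_trans hr.
have nobicl G : P G -> forall X Y : {set G},
    (forall u v, u \in X -> v \in Y -> edge u v) -> r - 3 < #|X| -> #|Y| < r.
  move=> /minor_free_no_model noF X Y XY tX; rewrite ltnNge; apply/negP => rY.
  apply: noF; apply: (biclique_model XY nab eab); rewrite cF; first lia.
  by rewrite rY andbT; apply: leq_trans hr.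
have LA (G : sgraph) (L : {set G}) l v : l \in L -> v \in common_nbr L -> edge l v.
  by move=> lL; rewrite inE => /forallP /(_ l); rewrite lL.
have [N1 hN1] : exists N, forall n (G : sgraph), #|G| = n -> N <= n -> P G ->
    (forall p, p \in ps -> size p = 2) ->
    (spectral_radius R G <= spectral_radius R (graphF n (r - 3)))%R /\
    (spectral_radius R G = spectral_radius R (graphF n (r - 3)) <->
      isomorphic G (graphF n (r - 3))).
  have [|N hN] := @join_extremal R (r - 3) _ r P matching_part t0 D0
    card_matching_part sparse nobicl; last by exists N => n G Gn nN PG _; apply: hN.
  move=> G L /minor_free_no_model noF cL tG Ar; apply: matching_embedding => //.
    rewrite -setI_eq0; apply/eqP/setP => l; rewrite in_setI in_set0; apply/negP.
    by case/andP => lL /(LA _ _ _ _ lL); rewrite edge_irrefl.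
  move=> u v w uA vA wA uw vw; apply/eqP; apply: contraT => nuv.
  have [c cab] : exists c : F, c \notin [set a; b].
    apply/existsP; apply: contraT; rewrite negb_exists => /forallP h.
    have : #|F| <= #|[set a; b]|.
      by apply: subset_leq_card; apply/subsetP => c _; have := h c; rewrite negbK.
    by rewrite cF cards2 nab leqNgt (leq_trans _ hr).
  case: noF; apply: (@biclique3_model F G L (common_nbr L) a b c u v w).
  - exact: LA.
  - move: cab; rewrite /= !inE !negb_or nab /= => /andP [ca cb].
    by rewrite eq_sym ca eq_sym cb.
  - exact: eab.
  - by rewrite cF cL; lia.
  - by rewrite cF.
  - by apply/allP; rewrite /= uA vA wA.
  - rewrite /= !inE negb_or nuv /= andbT; apply/andP; split.
      by apply: contraTneq uw => ->; rewrite edge_irrefl.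
    by apply: contraTneq vw => ->; rewrite edge_irrefl.
  - exact: uw.
  - by [].
have [N2 hN2] : exists N, forall n (G : sgraph), #|G| = n -> N <= n -> P G ->
    (exists2 p, p \in ps & 3 <= size p) ->
    (spectral_radius R G <= spectral_radius R (graphS n (r - 3)))%R /\
    (spectral_radius R G = spectral_radius R (graphS n (r - 3)) <->
      isomorphic G (graphS n (r - 3))).
  have [/hasP [p pP sp]|none] := boolP (has (fun p => 3 <= size p) ps); last first.
    by exists 0 => n G _ _ _ [p pP sp]; case/negP: none; apply/hasP; exists p.
  have [x [y [z [s pE]]]] : exists x y z s, p = [:: x, y, z & s].
    by case: p sp {pP} => [|x [|y [|z s]]] // _; exists x, y, z, s.
  rewrite {}pE in pP; have := hpath _ pP => /= /and4P [xu yu _ _].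
  have exy := path_head_nonadjacent (s1 := [::]) pP.
  have eyz := path_head_nonadjacent (s1 := [:: x]) pP.
  have [|N hN] := @join_extremal R (r - 3) _ r P edgeless t0 D0
    card_ord sparse nobicl; last by exists N => n G Gn nN PG _; apply: hN.
  move=> G L /minor_free_no_model noF cL tG Ar; apply: edgeless_embedding => //.
  move=> u w uA wA; apply/negP => uw.
  (* A place for the middle vertex [y]: its edges to [x] and [z] are both deleted, so the single
     edge [uw], realizing [xz], already gives an [F]-minor. *)
  have [v vA] : exists v, v \in common_nbr L :\: [set u; w].
    apply/card_gt0P; rewrite cardsD subn_gt0; apply: leq_trans (leq_trans hr Ar).
    rewrite ltnS; apply: leq_trans (subset_leq_card (subsetIr _ _)) _.
    by rewrite cards2; case: eqP.
  move: vA; rewrite in_setD !inE negb_or => /andP [/andP [vu vw] vA].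
  case: noF; apply: (@biclique3_model F G L (common_nbr L) x y z u v w).
  - exact: LA.
  - move: xu yu; rewrite /= !inE !negb_or => /and3P [-> -> _] /andP [-> _].
    by [].
  - exact: exy.
  - by rewrite cF cL; lia.
  - by rewrite cF.
  - by apply/allP; rewrite /= uA wA andbT; rewrite inE vA.
  - rewrite /= !inE negb_or eq_sym vu vw /= andbT.
    by apply: contraTneq uw => ->; rewrite edge_irrefl.
  - exact: uw.
  - by rewrite (negPf eyz).
exists (maxn N1 N2) => n G Gn; rewrite geq_max => /andP [n1 n2] PG.
by split; [apply: hN1|apply: hN2].
Qed.
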